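(* Let $F=\mathbb{Z}/2$ and let $N\ge 3$ be an odd integer. In each of the following three cases the triple $(V,\langle,\rangle,e:S\to V)$ is perfect (as defined in the context). (a) $V$ is an $F$-vector space with a symplectic form $\langle,\rangle$ and a map $e:S\to V$ from a finite set $S$ such that $\{e_s; s\in S\}$ is a basis of $V$ (indexed by $S$) and the graph $(S,\mathfrak{E})$ is of type $A_{N-1}$, that is, a path with $N-1$ vertices. (b) $V$ is an $F$-vector space with a symplectic form $\langle,\rangle$ and a map $e:S\to V$ from a finite set $S$ such that $\{e_s; s\in S\}$ is a basis of $V$ (indexed by $S$) and the graph $(S,\mathfrak{E})$ is of affine type $A_{N-1}$, that is, a cycle with $N$ vertices. (c) With $V,\langle,\rangle,e$ as in (b), the triple is $(\bar V,\langle,\rangle,\pi\circ e:S\to\bar V)$, where $\bar V=V/Fe_S$ with $e_S=\sum_{s\in S}e_s$, $\pi:V\to\bar V$ is the quotient map, and $\langle,\rangle$ on $\bar V$ is the form induced from $V$.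
   Context: Let $V$ be a finite dimensional vector space over $F=\mathbb{Z}/2$ with a symplectic (bilinear alternating, possibly degenerate) form $\langle,\rangle:V\times V\to F$ and a map $e:S\to V$, $s\mapsto e_s$, with $S$ a finite set. Let $\mathfrak{E}$ be the set of unordered pairs $\{s,s'\}$, $s\neq s'$ in $S$, with $\langle e_s,e_{s'}\rangle=1$; $(S,\mathfrak{E})$ is a graph with vertex set $S$ and edge set $\mathfrak{E}$. For $I\subset S$ put $e_I=\sum_{s\in I}e_s\in V$ and let $\underline{I}$ be the full subgraph of $(S,\mathfrak{E})$ with vertex set $I$. Let $\mathcal{I}$ be the set of all $I\subset S$ such that $\underline{I}$ is a graph of type $A_m$ (a path with $m$ vertices) for some $m\ge1$; $\mathcal{I}^1=\{I\in\mathcal{I}; |I|\text{ odd}\}$. For $I,I'\in\mathcal{I}^1$: write $I\prec I'$ if $I\subsetneq I'$ and $\underline{I'-I}$ is disconnected; write $I\spadesuit I'$ if $I\cap I'=\emptyset$ and $\underline{I\cup I'}$ is disconnected. For $I\in\mathcal{I}^1$ let $I^{ev}$ be the set of $s\in I$ such that $I-\{s\}=I'\sqcup I''$ with $I',I''\in\mathcal{I}^1$, $I'\spadesuit I''$. $R$ is the set of finite subsets of $\mathcal{I}^1$. For $B\in R$ let $L_B$ be the subspace of $V$ spanned by $\{e_I;I\in B\}$; for a subspace $L\subset V$ let $B_L=\{I\in\mathcal{I}^1; e_I\in L\}$. For $s\in S$, $B\in R$ let $g_s(B)=|\{I\in B; s\in I\}|$, let $\epsilon_s(B)=\frac12 g_s(B)(g_s(B)+1)\in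 F$ (reduced mod 2) and $\epsilon(B)=\sum_{s\in S}\epsilon_s(B)e_s\in V$. $\phi(V)$ is the set of all $B\in R$ such that: $(P_0)$ if $I,I'\in B$ then $I=I'$ or $I\spadesuit I'$ or $I\prec I'$ or $I'\prec I$; $(P_1)$ for each $I\in B$ there exist $I_1,\dots,I_k\in B$ ($k\ge0$), pairwise disjoint, with $I_j\prec I$ for all $j$ and $I^{ev}\subset I_1\cup\dots\cup I_k$. $(V,\langle,\rangle,e)$ is called perfect if: (i) for any $B\in\phi(V)$, $\{e_I; I\in B\}$ (indexed by $B$) is a basis of $L:=L_B$, and $B=B_L$; (ii) for any $B\in\phi(V)$, $\epsilon(B)\in L_B$; hence $\epsilon$ restricts to a map $\epsilon:\phi(V)\to V_0$ where $V_0=\bigcup_{B\in\phi(V)}L_B$; (iii) the map $\epsilon:\phi(V)\to V_0$ is a bijection; (iv) if $B,B'\in\phi(V)$ satisfy $\epsilon(B')\in L_B$, then $g_s(B')\le g_s(B)$ for all $s\in S$. *)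

(* Defs.v *)
From HB Require Import structures.
From mathcomp Require Import all_boot all_algebra.

Set Implicit Arguments.
Unset Strict Implicit.
Unset Printing Implicit Defensive.

Import GRing.Theory VectorInternalTheory.
Local Open Scope ring_scope.
Local Open Scope quotient_scope.

(* The quotient vector space vT / U. Its carrier and additive group are the
   library's {ideal_quot U}; only the scaling and finite dimension are added here. *)
Section QuotientSpace.
Variables (K : fieldType) (vT : vectType K) (U : {vspace vT}).

Definition quotv : Type := {ideal_quot (pred_of_vspace U : zmodClosed vT)}.

HB.instance Definition _ := Choice.on quotv.
HB.instance Definition _ := GRing.Zmodule.on quotv.

Definition piv (x : vT) : quotv :=
  \pi_{ideal_quot (pred_of_vspace U : zmodClosed vT)} x.

Definition reprv (x : quotv) : vT :=
  repr (x : {ideal_quot (pred_of_vspace U : zmodClosed vT)}).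

Lemma reprvK : cancel reprv piv.
Proof. exact: reprK. Qed.

Lemma piv_eqE x y : (piv x == piv y) = (x - y \in U).
Proof. by rewrite /piv -Quotient.idealrBE. Qed.

Lemma pivD : {morph piv : x y / x + y}.
Proof. by move=> x y; rewrite /piv [LHS]raddfD. Qed.

Definition scaleqv (a : K) (x : quotv) : quotv := piv (a *: reprv x).

Lemma pivZ a x : piv (a *: x) = scaleqv a (piv x).
Proof.
apply/eqP; rewrite piv_eqE -scalerBr memvZ // -piv_eqE.
by rewrite reprvK.
Qed.

Fact scaleqvA a b x : scaleqv a (scaleqv b x) = scaleqv (a * b) x.
Proof. by rewrite -[x]reprvK -!pivZ scalerA. Qed.

Fact scaleqv1 : left_id 1 scaleqv.
Proof. by move=> x; rewrite -[x]reprvK -pivZ scale1r. Qed.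

Fact scaleqvDr : right_distributive scaleqv +%R.
Proof.
by move=> a x y; rewrite -[x]reprvK -[y]reprvK -pivD -!pivZ scalerDr pivD.
Qed.

Fact scaleqvDl x : {morph scaleqv^~ x : a b / a + b}.
Proof. by move=> a b; rewrite -[x]reprvK -!pivZ scalerDl pivD. Qed.

HB.instance Definition _ :=
  GRing.Zmodule_isLmodule.Build K quotv scaleqvA scaleqv1 scaleqvDr scaleqvDl.

Fact piv_is_linear : linear piv.
Proof. by move=> a x y; rewrite pivD pivZ. Qed.

HB.instance Definition _ := GRing.isLinear.Build K vT quotv _ piv piv_is_linear.

(* quotv is isomorphic to the complement U^C, by projection along U. *)
Let W := subvs_of U^C.
Let toW (x : quotv) : W := vsproj U^C (daddv_pi U^C U (reprv x)).

Let capCU : (U^C :&: U = 0)%VS.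
Proof. by rewrite capvC capv_compl. Qed.

Let toW_piv x : toW (piv x) = vsproj U^C (daddv_pi U^C U x).
Proof.
congr vsproj; apply/eqP; rewrite -subr_eq0 -linearB /=.
have : reprv (piv x) - x \in U by rewrite -piv_eqE reprvK.
set u := _ - _ => Uu.
have := daddv_pi_add capCU (subvP (addvSr U^C U) _ Uu).
rewrite (daddv_pi_id (etrans (capvC _ _) capCU) Uu).
by move=> /(canRL (addrK _)) ->; rewrite subrr.
Qed.

Fact quotv_vectAxiom : Vector.axiom (\dim (U^C)%VS) quotv.
Proof.
exists (fun x => v2r (toW x)).
  move=> a x y; rewrite -[x]reprvK -[y]reprvK -linearP /= !toW_piv.
  by rewrite !linearP.
exists (fun r => piv (vsval (r2v r : W))) => [x|r] /=.
  rewrite v2rK -[x]reprvK toW_piv vsprojK ?memv_pi //.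
  apply/eqP; rewrite piv_eqE.
  have xUU : reprv x \in (U^C + U)%VS by rewrite addvC addv_complf memvf.
  rewrite -{2}(daddv_pi_add capCU xUU) opprD addrA subrr add0r memvN.
  exact: memv_pi.
by rewrite toW_piv (daddv_pi_id capCU) ?subvsP // vsvalK r2vK.
Qed.

HB.instance Definition _ := Lmodule_hasFinDim.Build K quotv quotv_vectAxiom.

End QuotientSpace.

Section Graphs.
Variables (T : finType) (g : rel T).

Definition induced (J : {set T}) : rel T :=
  [rel x y | [&& x \in J, y \in J & g x y]].

Definition disconnected (J : {set T}) : bool :=
  [exists x in J, exists y in J, ~~ connect (induced J) x y].

(* The full subgraph on J is isomorphic to the graph h on {0, ..., m - 1}. *)
Definition isog_on (J : {set T}) (m : nat) (h : rel 'I_m) : bool :=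
  [exists f : {ffun 'I_m -> T},
    [&& injectiveb f, [set f i | i : 'I_m] == J &
        [forall i, forall j, g (f i) (f j) == h i j]]].

End Graphs.

Definition path_rel (m : nat) : rel 'I_m :=
  [rel i j : 'I_m | (i.+1 == j :> nat) || (j.+1 == i :> nat)].

(* This is the m-cycle only for m >= 3. *)
Definition cycle_rel (m : nat) : rel 'I_m :=
  [rel i j : 'I_m | (i.+1 %% m == j)%N || (j.+1 %% m == i)%N].

Definition alternating (V : vectType 'F_2) (form : {biscalar V}) : Prop :=
  forall x, form x x = 0.

Section Perfect.
Variables (V : vectType 'F_2) (form : {biscalar V}) (S : finType) (e : S -> V).
Implicit Types (X Y : {set S}) (B : {set {set S}}).

Definition edge : rel S := [rel s t | (s != t) && (form (e s) (e t) == 1)].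

Definition esum X : V := \sum_(s in X) e s.

(* A path on X has #|X| vertices, so m = #|X| is the only possible length. *)
Definition paths : {set {set S}} :=
  [set X : {set S} | (0 < #|X|)%N && isog_on edge X (@path_rel #|X|)].

Definition opaths : {set {set S}} := [set X in paths | odd #|X|].

Definition prec X Y : bool := (X \proper Y) && disconnected edge (Y :\: X).

Definition spade X Y : bool :=
  [disjoint X & Y] && disconnected edge (X :|: Y).

Definition ev X : {set S} :=
  [set s in X | [exists Y in opaths, exists Z in opaths,
     (X :\ s == Y :|: Z) && spade Y Z]].

Definition spanL B : {vspace V} := <<[seq esum X | X in B]>>%VS.

Definition setL (L : {vspace V}) : {set {set S}} :=
  [set X in opaths | esum X \in L].

Definition mult B (s : S) : nat := #|[set X in B | s \in X]|.

Definition eps B : V :=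
  \sum_(s : S) ((mult B s * (mult B s).+1) %/ 2)%N%:R *: e s.

Definition P0 B : bool :=
  [forall X in B, forall Y in B, [|| X == Y, spade X Y, prec X Y | prec Y X]].

(* The pairwise disjoint I_1, ..., I_k are the members of the family C. They
   are nonempty, hence distinct, so a set of sets loses nothing. *)
Definition P1 B : bool :=
  [forall X in B, exists C : {set {set S}},
    [&& C \subset B, trivIset C, [forall Y in C, prec Y X] &
        ev X \subset cover C]].

Definition phi : {set {set {set S}}} :=
  [set B : {set {set S}} | [&& B \subset opaths, P0 B & P1 B]].

Definition V0 : pred V := [pred v | [exists B in phi, v \in spanL B]].

Record perfect : Prop := Perfect {
  perfect_basis : {in phi, forall B,
    basis_of (spanL B) [seq esum X | X in B] /\ B = setL (spanL B)};
  perfect_eps : {in phi, forall B, eps B \in spanL B};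
  perfect_inj : {in phi &, injective eps};
  perfect_surj : {in V0, forall v, exists2 B, B \in phi & eps B = v};
  perfect_mult : {in phi &, forall B B', eps B' \in spanL B ->
    forall s, (mult B' s <= mult B s)%N}
}.

End Perfect.

(* Main.v *)
(* Place S on a cycle of N vertices; a path on N - 1 vertices omits one of them.
   An odd path is an arc, and an arc is a chord joining the two edges of the cycle
   that bound it; e_I only records these two edges.  The families B in phi(V) are
   then exactly the noncrossing partial matchings of the N edges with no unmatched
   edge beneath a chord, which makes {e_I; I in B} independent and gives B = B_L.

   Such a matching is equivalent to its depth function h = g(B) on the vertices, and
   the functions that occur are those that change by 1 along every edge, except that
   two neighbours may both have depth 0.  The parity of h (h + 1) / 2 changes along
   an edge exactly when the larger of its two depths is odd, so eps(B) is the sum of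
   the e_I at odd depth, and this lies in L_B.  Conversely, writing
   f = (-1)^h (2 h + 1), the class of eps(B) determines f(x) + f(x + 1) for every x,
   being 2 or -2; since N is odd this determines f, hence h, hence B, so that eps is
   injective.

   If v in L_B is the sum of e_I over I in A, where A is a subset of B, start from
   depth 0 outside all chords and let the depth jump, on entering a chord, by the
   involution (0 1)(2 3)... or (1 2)(3 4)... according to whether the chord is in A.
   This is an admissible function bounded by g(B), whose matching B' satisfies
   eps(B') = v.  So eps is onto, and by injectivity eps(B') in L_B forces
   g(B') <= g(B). *)
Require Import Defs.
From HB Require Import structures.
From mathcomp Require Import all_boot all_algebra zify.

Set Implicit Arguments.
Unset Strict Implicit.
Unset Printing Implicit Defensive.

Import GRing.Theory.
Local Open Scope ring_scope.

Ltac nat_lia :=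
  repeat match goal with
  | H : ?P |- _ => lazymatch P with
      | is_true (leq _ _) => fail
      | is_true (andb _ _) => fail
      | is_true (odd _) => fail
      | is_true (negb (odd _)) => fail
      | is_true (negb (leq _ _)) => fail
      | is_true (negb (@eq_op ?A _ _)) => tryif unify A nat then fail else clear H
      | @eq ?A _ _ => tryif unify A nat then fail else clear H
      | not (@eq ?A _ _) => tryif unify A nat then fail else clear H
      | nat => fail
      | _ => clear H
      end
  end; lia.

(** * Arcs of a cycle *)

Section Cycle.
Variable n : nat.
Local Notation T := 'I_n.+3.
Implicit Types (x y z a b : T) (I J : {set T}) (A B : {set {set T}}).

Lemma val_cycD1 x : (x + 1 : T) = (if x.+1 == n.+3 then 0 else x.+1) :> nat.
Proof.
rewrite /= (modn_small (_ : 1 < n.+3)%N) // addn1.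
by have := ltn_ord x; case: eqP => [->|ne] ?; rewrite ?modnn // modn_small //; lia.
Qed.

Lemma val_cycB x (m : nat) : (m < n.+3)%N ->
  (x - m%:R : T) = (if (m <= x)%N then x - m else x + n.+3 - m)%N :> nat.
Proof.
move=> lt_m; rewrite Zp_nat /= (modn_small lt_m) modnDmr.
have := ltn_ord x; case: (leqP m x) => [le_m|lt_x] ltx.
  rewrite (_ : (x + (n.+3 - m) = x - m + n.+3)%N); last lia.
  by rewrite modnDr modn_small; lia.
by rewrite modn_small; lia.
Qed.

Lemma val_cycB1 x : (x - 1 : T) = (if x == 0 :> nat then n.+2 else x.-1) :> nat.
Proof.
rewrite -[1](natr_Zp (1 : T)) val_cycB //=.
by have := ltn_ord x; case: (nat_of_ord x) => [|i]; rewrite ?modn_small //=; lia.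
Qed.

Lemma val_cyc_nat (m : nat) : (m < n.+3)%N -> (m%:R : T) = m :> nat.
Proof. by move=> lt_m; rewrite Zp_nat /= modn_small. Qed.

Lemma cyc_natr : (n.+3)%:R = 0 :> T.
Proof. by apply: val_inj; rewrite Zp_nat /= modnn. Qed.

Lemma cyc_ind (P : T -> Prop) z :
  P z -> (forall x, P x -> P (x + 1)) -> forall x, P x.
Proof.
move=> Pz PS x; have -> : x = z + (val (x - z))%:R by rewrite natr_Zp addrC subrK.
by elim: (val _) => [|k IH]; rewrite ?addr0 // -natr1 addrA; apply: PS.
Qed.

(** One full turn around the cycle negates the value an odd number of times. *)
Lemma cyc_odd_alt (G : zmodType) (F : T -> G) : odd n.+3 ->
  (forall x, F (x + 1) = - F x) -> forall x, F x = - F x.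
Proof.
move=> oddN FS x.
have FD k : F (x + k%:R) = if odd k then - F x else F x.
  elim: k => [|k IH]; first by rewrite addr0.
  by rewrite -natr1 addrA FS IH /=; case: (odd k); rewrite ?opprK.
by rewrite -{1}[x]addr0 -cyc_natr FD oddN.
Qed.

(** The offset [x - a] is read in {0, ..., N - 1}, so an arc passing through 0 needs no separate
    case. *)
Definition carc a (m : nat) : {set T} := [set x : T | ((x - a)%R < m)%N].

Lemma mem_arc a m x : (x \in carc a m) = ((x - a)%R < m)%N.
Proof. by rewrite inE. Qed.

Lemma arc_nat a m i : (i < n.+3)%N -> (a + i%:R \in carc a m) = (i < m)%N.
Proof. by move=> lt_i; rewrite mem_arc addrC addKr val_cyc_nat. Qed.

Lemma arcP a m x :
  reflect (exists2 i, (i < m)%N & (i < n.+3)%N /\ x = a + i%:R) (x \in carc a m).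
Proof.
apply: (iffP idP) => [|[i lt_im [lt_i ->]]]; last by rewrite arc_nat.
rewrite mem_arc => lt_x; exists (val (x - a)) => //; split; first exact: ltn_ord.
by rewrite natr_Zp addrC subrK.
Qed.

Lemma arcC a m : (m <= n.+3)%N -> ~: carc a m = carc (a + m%:R) (n.+3 - m).
Proof.
rewrite leq_eqVlt => /predU1P[->|lt_m].
  by apply/setP=> x; rewrite !inE subnn ltn0 ltn_ord.
apply/setP=> x; rewrite !inE opprD addrA val_cycB //.
have := ltn_ord (x - a); move: (nat_of_ord _) => i.
by case: (leqP m i) => ?; lia.
Qed.

Lemma arcD a l m : (m <= l)%N -> (l < n.+3)%N ->
  carc a l :\: carc a m = carc (a + m%:R) (l - m).
Proof.
move=> le_ml lt_l; apply/setP=> x.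
rewrite !inE opprD addrA val_cycB; last exact: leq_ltn_trans lt_l.
have := ltn_ord (x - a); move: (nat_of_ord _) => i.
by case: (leqP m i) => ?; lia.
Qed.

(** An arc is connected, so a property that passes between neighbours spreads; every vertex is
    compared with the first one, [a]. *)
Lemma arc_connect a m (P : T -> Prop) :
  (forall x, x \in carc a m -> x + 1 \in carc a m -> P x <-> P (x + 1)) ->
  forall x y, x \in carc a m -> y \in carc a m -> P x -> P y.
Proof.
move=> PS.
have Pa i : (i < m)%N -> (i < n.+3)%N -> P a <-> P (a + i%:R).
  elim: i => [|i IH] lt_im lt_i; first by rewrite addr0.
  rewrite IH ?(ltnW lt_im) ?(ltnW lt_i) // -natr1 addrA; apply: PS.
    by rewrite arc_nat ltnW.
  by rewrite -addrA natr1 arc_nat.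
move=> x y /arcP[i lt_i [Ni ->]] /arcP[j lt_j [Nj ->]].
by move/Pa => /(_ lt_i Ni) /Pa; apply.
Qed.

Lemma card_arc a m : (m <= n.+3)%N -> #|carc a m| = m.
Proof.
move=> le_m; rewrite -[RHS]card_ord.
have le_i (i : 'I_m) : (i < n.+3)%N by apply: leq_trans le_m.
have ->: carc a m = [set a + (val i)%:R | i : 'I_m].
  apply/setP=> x; apply/arcP/imsetP => [[i lt_i [_ ->]]|[i _ ->]].
    by exists (Ordinal lt_i).
  by exists i.
rewrite card_imset // => i j /addrI /(congr1 (@nat_of_ord _)).
by rewrite !val_cyc_nat //; [move/val_inj | exact: le_i | exact: le_i].
Qed.

(** The strict bound excludes the whole cycle, which has no ends. *)
Definition oarc I : Prop := exists a m, [/\ odd m, (m < n.+3)%N & I = carc a m].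

(* The edge between x and x + 1 is an end of the arc I. *)
Definition sep x I : bool := (x \in I) != (x + 1 \in I).

Lemma sep_arc a m x : (0 < m < n.+3)%N ->
  sep x (carc a m) = (x + 1 == a) || (x + 1 == a + m%:R).
Proof.
move=> /andP[m_gt0 lt_m]; rewrite /sep !mem_arc.
have -> : (x + 1 == a + m%:R) = (x + 1 - a == m%:R) by rewrite subr_eq [a + _]addrC.
rewrite -[x + 1 == a]subr_eq0 [x + 1 - a]addrAC.
have val_eq (u v : T) : (u == v) = (nat_of_ord u == v) by [].
rewrite !val_eq val_cycD1 val_cyc_nat //; have := ltn_ord (x - a).
by move: (nat_of_ord (x - a)) => i; case: (i.+1 =P n.+3) => ? ?;
  case: (ltnP i m) => ?; case: ltnP => ? /=; lia.
Qed.


(** * Arc systems and their depth functions *)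

Definition noncrossing B : Prop :=
  (forall I J x, I \in B -> J \in B -> x \in I -> x \in J ->
     (I \subset J) || (J \subset I)) /\
  (forall I J x, I \in B -> J \in B -> sep x I -> sep x J -> I = J).

(* Conditions (P_0) and (P_1) for odd arcs, which are viewed as chords joining
   their two ends: the chords do not cross, share no end, and leave no edge
   beneath a chord unmatched. *)
Definition arc_system B : Prop :=
  [/\ forall I, I \in B -> oarc I, noncrossing B &
      forall a m j, carc a m \in B -> odd m -> (m < n.+3)%N -> odd j -> (j < m)%N ->
        exists J, [/\ J \in B, J \proper carc a m & a + j%:R \in J]].

Lemma noncrossing_sub B B' : B' \subset B -> noncrossing B -> noncrossing B'.
Proof.
by move=> /subsetP sB [lam inj]; split=> I J x /sB BI /sB BJ; [apply: lam|apply: inj].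
Qed.

(** Two members never end on the same edge, so only [I] distinguishes [x] from [x + 1]. *)
Lemma mult_up B I x : noncrossing B -> I \in B -> x \notin I -> x + 1 \in I ->
  mult B (x + 1) = (mult B x).+1.
Proof.
move=> [_ inj] BI xI x1I; rewrite /mult.
have -> : [set J in B | x + 1 \in J] = I |: [set J in B | x \in J].
  apply/setP=> J; rewrite !inE; case: eqP => [->|neJ] /=; first by rewrite BI x1I.
  case BJ: (J \in B) => //=; apply/eqP/negPn/negP=> sepJ; case: neJ.
  by apply: (inj _ _ x) => //; rewrite /sep ?(negPf xI) ?x1I // eq_sym.
by rewrite cardsU1 inE BI (negPf xI).
Qed.

Lemma mult_down B I x : noncrossing B -> I \in B -> x \in I -> x + 1 \notin I ->
  mult B x = (mult B (x + 1)).+1.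
Proof.
move=> [_ inj] BI xI x1I; rewrite /mult.
have -> : [set J in B | x \in J] = I |: [set J in B | x + 1 \in J].
  apply/setP=> J; rewrite !inE; case: eqP => [->|neJ] /=; first by rewrite BI xI.
  case BJ: (J \in B) => //=; apply/eqP/negPn/negP=> sepJ; case: neJ.
  by apply: (inj _ _ x) => //; rewrite /sep ?(negPf x1I) ?xI.
by rewrite cardsU1 inE BI (negPf x1I).
Qed.

Lemma mult_flat B x : (forall I, I \in B -> ~~ sep x I) -> mult B (x + 1) = mult B x.
Proof.
move=> flat; apply: eq_card => J; rewrite !inE.
by case BJ: (J \in B) => //=; have := flat J BJ; rewrite negbK => /eqP ->.
Qed.

(** At most one member ends on an edge, and it shifts the depth by 1. Vectors of a span only
    remember parities of depths; this recovers the ends from them. *)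
Lemma odd_mult_sep B x : noncrossing B ->
  (odd (mult B x) != odd (mult B (x + 1))) = [exists I in B, sep x I].
Proof.
move=> ncB.
have [/existsP[I /andP[BI sepI]]|/existsPn flat] := boolP [exists I in B, sep x I].
  move: sepI; rewrite /sep; case xI: (x \in I); case x1I: (x + 1 \in I) => // _.
    by rewrite (mult_down ncB BI xI) ?x1I //=; case: odd.
  by rewrite (mult_up ncB BI _ x1I) ?xI //=; case: odd.
rewrite mult_flat ?eqxx // => I BI.
by have := flat I; rewrite BI.
Qed.

(* The profile of the depth function of an arc system, see [mult_admissible]
   and [level_arcs_system]. *)
Definition admissible (h : T -> nat) : Prop := forall x,
  [\/ h (x + 1) = (h x).+1, h x = (h (x + 1)).+1 | h x = 0%N /\ h (x + 1) = 0%N].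

Lemma smallest_containing B x : (0 < mult B x)%N ->
  exists2 I, I \in B & x \in I /\ forall J, J \in B -> x \in J -> (#|I| <= #|J|)%N.
Proof.
case/card_gt0P=> I0 BI0.
case: (@arg_minnP _ I0 [pred I | I \in [set I in B | x \in I]]
         (fun I : {set T} => #|I|) BI0) => I /=.
rewrite inE => /andP[BI xI] minI; exists I => //; split=> // J BJ xJ.
by apply: minI; rewrite inE BJ.
Qed.

(** Suppose that no member ends on the edge and that [x] has positive depth. The smallest member
    around [x] contains both vertices of the edge, one of them at odd offset, so a smaller member
    contains that vertex and hence also [x], a contradiction. *)
Lemma mult_admissible B : arc_system B -> admissible (mult B).
Proof.
move=> [arcB ncB evB] x.
case: (boolP [exists I in B, sep x I]) => [/existsP[I /andP[BI]]|/existsPn flat].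
  rewrite /sep; case xI: (x \in I); case x1I: (x + 1 \in I) => // _.
    by apply: Or32; apply: mult_down BI xI _; rewrite ?x1I.
  by apply: Or31; apply: mult_up BI _ x1I; rewrite ?xI.
have {}flat I : I \in B -> ~~ sep x I by move=> BI; have := flat I; rewrite BI.
rewrite mult_flat //; case: (posnP (mult B x)) => [->|]; first exact: Or33.
case/smallest_containing=> I BI [xI minI].
have [a [m [odd_m lt_m defI]]] := arcB I BI.
have x1I : x + 1 \in I by have := flat I BI; rewrite negbK xI => /eqP <-.
have: exists J, [/\ J \in B, J \proper I & (x \in J) || (x + 1 \in J)].
  move: xI x1I; rewrite defI => xI x1I; move: BI; rewrite defI => BI.
  have /arcP[i lt_im [lt_i def_x]] := xI.
  case odd_i: (odd i).
    have [J [BJ ltJ iJ]] := evB a m i BI odd_m lt_m odd_i lt_im.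
    by exists J; rewrite def_x iJ.
  have lt_i1 : (i.+1 < m)%N.
    rewrite ltn_neqAle lt_im andbT; apply/eqP=> m_i.
    by move: x1I; rewrite def_x -addrA natr1 arc_nat ?m_i ?ltnn.
  have [J [BJ ltJ iJ]] := evB a m i.+1 BI odd_m lt_m (negbT odd_i) lt_i1.
  by exists J; split=> //; rewrite def_x -addrA natr1 iJ orbT.
case=> J [BJ ltJ].
have -> : (x + 1 \in J) = (x \in J) by have := flat J BJ; rewrite negbK => /eqP.
rewrite orbb => xJ; have := minI J BJ xJ.
by rewrite leqNgt (proper_card ltJ).
Qed.

(** [J] is fenced off at level [k]: a connected set that meets [J] and on which [h] is at least [k]
    cannot leave [J]. *)
Definition out_below (h : T -> nat) (k : nat) J : Prop := forall x y,
  x \in J -> y \notin J -> (y = x + 1) \/ (x = y + 1) -> (h y < k)%N.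

Lemma arc_sub_level h k a m J x : (forall y, y \in carc a m -> (k <= h y)%N) ->
  out_below h k J -> x \in carc a m -> x \in J -> carc a m \subset J.
Proof.
move=> ge_k outJ xI xJ; apply/subsetP=> y yI.
apply: (@arc_connect a m (fun z => z \in J) _ x) => // z zI z1I.
split=> [zJ|z1J]; apply/negPn/negP=> out.
  by have:= outJ _ _ zJ out (or_introl erefl); rewrite ltnNge ge_k.
by have:= outJ _ _ z1J out (or_intror erefl); rewrite ltnNge ge_k.
Qed.

(** A member reaching a vertex just outside [J] also contains the neighbour inside, as it cannot
    share an end with [J]; by nesting it contains [J], hence [x]. So the members around the outer
    vertex are among those around [x], without [J]. *)
Lemma mult_level B J x : noncrossing B -> J \in B -> x \in J ->
    (forall I, I \in B -> x \in I -> J \subset I) ->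
  (forall y, y \in J -> (mult B x <= mult B y)%N) /\ out_below (mult B) (mult B x) J.
Proof.
move=> [lam inj] BJ xJ minJ; split=> [y yJ|y z yJ zJ adj].
  apply/subset_leq_card/subsetP=> I; rewrite !inE => /andP[BI xI].
  by rewrite BI (subsetP (minJ I BI xI)).
apply/proper_card/properP; split; last first.
  by exists J; rewrite !inE BJ ?xJ ?(negPf zJ).
apply/subsetP=> I; rewrite !inE => /andP[BI zI]; rewrite BI /=.
have yI : y \in I.
  apply/negPn/negP=> yI; suff eqI : I = J by rewrite eqI (negPf zJ) in zI.
  case: adj => def_; first by apply: (inj _ _ y);
    rewrite // /sep -def_ ?yJ ?zI ?(negPf yI) ?(negPf zJ).
  by apply: (inj _ _ z); rewrite // /sep -def_ ?yJ ?zI ?(negPf yI) ?(negPf zJ).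
case/orP: (lam I J y BI BJ yI yJ) => [/subsetP/(_ z zI)|/subsetP->//].
by rewrite (negPf zJ).
Qed.

Lemma arc_left a m : (0 < m < n.+3)%N -> a - 1 \notin carc a m /\ a \in carc a m.
Proof.
move=> /andP[m_gt0 lt_m]; split.
  by rewrite mem_arc addrAC val_cycB1 subrr /= -leqNgt.
by rewrite mem_arc subrr.
Qed.

(** A member [I] with first vertex [a] is the smallest one around [a], since a smaller one would
    share its left end. Hence [I], like the smallest member of [B'] around [a], is the component of
    [a] among the vertices at least as deep as [a]. *)
Lemma mult_inj_sub B B' : arc_system B -> arc_system B' -> mult B =1 mult B' ->
  B \subset B'.
Proof.
move=> [arcB ncB _] [arcB' ncB' _] eq_m; apply/subsetP=> I BI.
have [a [m [odd_m lt_m defI]]] := arcB I BI.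
have [|a1I aI] := @arc_left a m; first by rewrite lt_m; case: (m) odd_m.
rewrite -defI in a1I aI.
have minI K : K \in B -> a \in K -> I \subset K.
  move=> BK aK; have /orP[//|/subsetP sKI] := ncB.1 I K a BI BK aI aK.
  suff -> : I = K by [].
  apply: (ncB.2 I K (a - 1)) => //; rewrite /sep subrK ?(negPf a1I) ?aI ?aK //.
  by rewrite (negPf (contra (sKI _) a1I)).
have [geI outI] := mult_level ncB BI aI minI.
have : (0 < mult B' a)%N by rewrite -eq_m; apply/card_gt0P; exists I; rewrite inE BI.
case/smallest_containing=> J BJ [aJ minJ].
have minJ' K : K \in B' -> a \in K -> J \subset K.
  move=> BK aK; have /orP[//|sKJ] := ncB'.1 J K a BJ BK aJ aK.
  suff -> : J = K by [].
  by apply/eqP; rewrite eq_sym eqEcard sKJ minJ.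
have [geJ outJ] := mult_level ncB' BJ aJ minJ'.
have [b [l [_ _ defJ]]] := arcB' J BJ.
suff -> : I = J by [].
apply/eqP; rewrite eqEsubset; apply/andP; split.
  rewrite defI; apply: (@arc_sub_level (mult B') (mult B' a) _ _ _ a) => //;
    rewrite -?defI //.
  by move=> y /geI; rewrite !eq_m.
rewrite defJ; apply: (@arc_sub_level (mult B) (mult B a) _ _ _ a) => //;
  rewrite -?defJ //.
by move=> y /geJ; rewrite !eq_m.
Qed.

Lemma mult_inj B B' : arc_system B -> arc_system B' -> mult B =1 mult B' -> B = B'.
Proof.
by move=> sB sB' eq_m; apply/eqP; rewrite eqEsubset !mult_inj_sub // => x; rewrite eq_m.
Qed.

Lemma oarc_sep I : oarc I -> exists x, sep x I.
Proof.
case=> a [m [odd_m lt_m ->]]; exists (a - 1).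
by rewrite sep_arc ?subrK ?eqxx // lt_m; case: (m) odd_m.
Qed.

(** The hypothesis expresses e_J as the sum of e_I over [A], up to a constant around the cycle, so
    the ends of [J] are exactly those of the members of [A]. A member [I] ending at the left end of
    [J] has no end besides those of [J]; it is [J] or its complement, and the complement has even
    size. *)
Lemma span_mem A B J : odd n.+3 -> arc_system B -> A \subset B -> oarc J ->
    (forall x, (x \in J) (+) odd (mult A x) = (x + 1 \in J) (+) odd (mult A (x + 1))) ->
  J \in B.
Proof.
move=> oddN [arcB ncB _] sAB [a [m [odd_m lt_m defJ]]] const.
have ncA := noncrossing_sub sAB ncB.
have m_gt0 : (0 < m)%N by case: (m) odd_m.
have sepJ x : sep x J = [exists I in A, sep x I].
  rewrite -odd_mult_sep // /sep; move: (const x).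
  by case: (x \in J); case: (x + 1 \in J); case: (odd _); case: (odd _).
have : sep (a - 1) J by rewrite defJ sep_arc ?m_gt0 // subrK eqxx.
rewrite sepJ => /existsP[I /andP[AI sepI]].
have BI := subsetP sAB I AI; have [b [l [odd_l lt_l defI]]] := arcB I BI.
have sepIJ x : sep x I -> sep x J by move=> sIx; rewrite sepJ; apply/existsP;
  exists I; rewrite AI.
have constI c k : (forall x, x \in carc c k -> x + 1 \in carc c k -> ~~ sep x J) ->
    forall x y, x \in carc c k -> y \in carc c k -> (x \in I) = (y \in I).
  move=> noJ; suff PI x y : x \in carc c k -> y \in carc c k -> x \in I -> y \in I.
    by move=> x y xk yk; apply/idP/idP; apply: PI.
  move=> xk yk; apply: (@arc_connect c k (fun z => z \in I)) xk yk => z zk z1k.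
  by have /negP := noJ z zk z1k; rewrite /sep in sepIJ *;
    case: eqP (sepIJ z) => [->|_ /(_ isT)].
have constJ : forall x y, x \in J -> y \in J -> (x \in I) = (y \in I).
  by rewrite defJ; apply: constI => x xJ x1J; rewrite /sep defJ xJ x1J.
have constJC : forall x y, x \in ~: J -> y \in ~: J -> (x \in I) = (y \in I).
  rewrite defJ arcC 1?ltnW //; apply: constI => x; rewrite -arcC 1?ltnW // -defJ.
  by rewrite !inE /sep => /negPf -> /negPf ->.
have [|a1J aJ] := @arc_left a m; first by rewrite m_gt0.
rewrite -defJ in a1J aJ.
have [aI|aI] := boolP (a \in I); last first.
  suff defIC : I = ~: J.
    have := congr1 (fun K : {set T} => odd #|K|) defIC.
    rewrite {1}defI defJ arcC 1?ltnW // !card_arc ?leq_subr 1?ltnW // odd_l oddB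
      1?ltnW //.
    by rewrite oddN odd_m.
  apply/setP=> x; rewrite inE; have [xJ|xJ] := boolP (x \in J).
    by rewrite (constJ x a) // (negPf aI).
  rewrite (constJC x (a - 1)) ?inE //; move: sepI; rewrite /sep subrK (negPf aI).
  by case: (_ \in I).
suff <- : I = J by [].
apply/setP=> x; have [xJ|xJ] := boolP (x \in J); first by rewrite (constJ x a).
rewrite (constJC x (a - 1)) ?inE //; move: sepI; rewrite /sep subrK aI.
by case: (_ \in I).
Qed.

(** * Arc systems from depth functions *)

(** The proper components of the superlevel sets of [h], with the depth of the first vertex as
    level. Drawing [m] from [T] keeps the length below N. *)
Definition level_arcs (h : T -> nat) : {set {set T}} :=
  [set I | [exists a : T, exists m : T, [&& I == carc a m, (0 < m)%N,
     (h (a - 1)%R < h a)%N, (h (a + (m : nat)%:R)%R < h a)%N &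
     [forall x in carc a m, (h a <= h x)%N]]]].

Definition level_arc h a (m : nat) : Prop :=
  [/\ (0 < m < n.+3)%N, (h (a - 1)%R < h a)%N, (h (a + m%:R)%R < h a)%N &
      forall x, x \in carc a m -> (h a <= h x)%N].

Lemma level_arcsP h I :
  reflect (exists a m, level_arc h a m /\ I = carc a m) (I \in level_arcs h).
Proof.
rewrite inE; apply: (iffP existsP) => [[a /existsP[m]]|[a [m [[]]]]].
  case/and5P=> /eqP defI m_gt0 ha1 ham /forallP ge_a; exists a, m; split=> //.
  split=> //; first by rewrite m_gt0 ltn_ord.
  by move=> x; apply/implyP.
case/andP=> m_gt0 lt_m ha1 ham ge_a defI; exists a; apply/existsP.
exists (Ordinal lt_m); rewrite /= m_gt0 ha1 ham defI eqxx /=.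
by apply/forallP=> x; apply/implyP/ge_a.
Qed.

Lemma level_arc_out h a m : level_arc h a m -> out_below h (h a) (carc a m).
Proof.
move=> [rm ha1 ham _] x y xI yI; have [_ aI] := arc_left a rm.
have amI : a + m%:R \notin carc a m by rewrite arc_nat ?ltnn //; case/andP: rm.
case=> [def_y|def_x].
  have : sep x (carc a m) by rewrite /sep -def_y xI (negPf yI).
  by rewrite sep_arc // -def_y => /orP[]/eqP eq_y //; rewrite eq_y ?aI // in yI *.
have : sep y (carc a m) by rewrite /sep -def_x xI (negPf yI).
rewrite sep_arc // -def_x => /orP[]/eqP eq_x; last by rewrite -eq_x xI in amI.
by rewrite (_ : y = a - 1) // -eq_x def_x addrK.
Qed.

Lemma level_arc_sub h a m b l x : level_arc h a m -> level_arc h b l ->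
  (h a <= h b)%N -> x \in carc a m -> x \in carc b l -> carc b l \subset carc a m.
Proof.
move=> Lam [_ _ _ geJ] le_ab xI xJ.
apply: (@arc_sub_level h (h a)) (level_arc_out Lam) xJ xI => y /geJ.
exact: leq_trans.
Qed.

(** Without a zero the parity of [h] would flip along every edge, which is impossible around an odd
    cycle. *)
Lemma admissible_zero h : odd n.+3 -> admissible h -> exists z, h z = 0%N.
Proof.
move=> oddN adm; have [/existsP[z /eqP]|/existsPn pos] := boolP [exists z, h z == 0%N].
  by exists z.
have /(cyc_odd_alt oddN)/(_ 0) : forall x, (-1 : int) ^+ h (x + 1)%R = - (-1) ^+ h x.
  move=> x; case: (adm x) => [->|->|[/eqP]]; rewrite ?exprS ?mulN1r ?opprK //.
  by rewrite (negPf (pos x)).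
by rewrite -signr_odd; case: odd.
Qed.

(** Walk from [y] in both directions until the depth falls below [j]; a zero of [h] stops both
    walks. Depth changes by at most 1 per step, so the arc starts at depth exactly [j]. *)
Lemma level_arc_ex h j y : odd n.+3 -> admissible h -> (0 < j <= h y)%N ->
  exists a m, [/\ level_arc h a m, y \in carc a m & h a = j].
Proof.
move=> oddN adm /andP[j_gt0 le_j]; have [z hz] := admissible_zero oddN adm.
have def_y : y = z + (val (y - z))%:R by rewrite natr_Zp addrC subrK.
have lt_v : (val (y - z)%R < n.+3)%N := ltn_ord _;
  move: (val _) def_y lt_v => v def_y lt_v.
have v_gt0 : (0 < v)%N.
  by rewrite lt0n; apply/eqP=> v0; move: le_j; rewrite def_y v0 addr0 hz leqNgt j_gt0.
(* Testing at [i.+1] makes the minimal [i] the last offset at which the depth is still at least [j].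
   The zero [z] lies [v] steps to the left and N - [v] to the right. *)
have exl : exists i, (h (y - i.+1%:R)%R < j)%N.
  by exists v.-1; rewrite prednK // def_y addrK hz.
have wrap : y + (n.+3 - v).-1.+1%:R = z.
  rewrite (_ : (n.+3 - v).-1.+1 = (n.+3 - v)%N); last lia.
  by rewrite def_y -addrA -natrD subnKC ?cyc_natr ?addr0 // ltnW.
have exr : exists i, (h (y + i.+1%:R)%R < j)%N.
  by exists (n.+3 - v).-1; rewrite wrap hz.
case: (ex_minnP exl) => i lt_il minl; case: (ex_minnP exr) => r lt_r minr.
have le_iv : (i <= v.-1)%N by apply: minl; rewrite prednK // def_y addrK hz.
have le_rv : (r <= (n.+3 - v).-1)%N by apply: minr; rewrite wrap hz.
pose a := y - i%:R; pose m := (i + r).+1.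
(* Both walks stop before [z], so the arc has at most N - 1 vertices. *)
have rm : (0 < m < n.+3)%N by rewrite /m; lia.
have ge_l k : (k <= i)%N -> (j <= h (y - k%:R)%R)%N.
  case: k => [|k] le_k; first by rewrite subr0.
  by rewrite leqNgt; apply/negP=> /minl; rewrite leqNgt le_k.
have ge_r k : (k <= r)%N -> (j <= h (y + k%:R)%R)%N.
  case: k => [|k] le_k; first by rewrite addr0.
  by rewrite leqNgt; apply/negP=> /minr; rewrite leqNgt le_k.
have lt_a1 : (h (a - 1)%R < j)%N by rewrite /a -addrA -opprD natr1.
have ha : h a = j.
  have := adm (a - 1); rewrite subrK; have := ge_l i (leqnn i); rewrite -/a.
  by move: lt_a1 j_gt0 => ? ? ? []; lia.
exists a, m; split=> //; last first.
  rewrite (_ : y = a + i%:R); last by rewrite subrK.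
  by rewrite arc_nat ?ltnS ?leq_addr //; case/andP: rm; rewrite /m; lia.
rewrite /level_arc ha; split=> //; first by rewrite /a /m -addnS natrD addrA subrK.
move=> x /arcP[t lt_t [_ ->]]; rewrite /a; case: (leqP t i) => le_ti.
  rewrite (_ : y - i%:R + t%:R = y - (i - t)%:R) ?ge_l ?leq_subr //.
  by rewrite natrB // opprB addrA addrAC.
rewrite (_ : y - i%:R + t%:R = y + (t - i)%:R); first by apply: ge_r;
  rewrite /m in lt_t; lia.
by rewrite natrB 1?ltnW // addrA addrAC.
Qed.

(** The flat case of admissibility occurs only at depth 0, so each step from a vertex of the arc
    flips the parity. The bound [i <= m] includes the vertex just past the arc. *)
Lemma odd_admissible h a m i : admissible h -> (m < n.+3)%N ->
    (forall x, x \in carc a m -> (0 < h x)%N) -> (i <= m)%N ->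
  odd (h (a + i%:R)%R) = odd (h a) (+) odd i.
Proof.
move=> adm lt_m pos; elim: i => [|i IH] le_i; first by rewrite addr0 addbF.
have := pos (a + i%:R); rewrite arc_nat; last exact: ltn_trans lt_m.
move=> /(_ le_i).
rewrite -natr1 addrA; move: (IH (ltnW le_i)) => /=.
case: (adm (a + i%:R)) => [->|e|[-> //]] IHi _; first by rewrite /= IHi addbN.
by move: IHi; rewrite e /= addbN => <-; rewrite negbK.
Qed.

(** Components of superlevel sets are nested or disjoint. On an edge where two of them end, the
    deeper vertex lies in both and its depth is the level of both, so they coincide. *)
Lemma level_arcs_noncrossing h : admissible h -> noncrossing (level_arcs h).
Proof.
move=> adm; split=> I J x /level_arcsP[a [m [LI ->]]] /level_arcsP[b [l [LJ ->]]].
  move=> xI xJ; case: (leqP (h a) (h b)) => [le_ab|/ltnW le_ba].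
    by rewrite (level_arc_sub LI LJ le_ab xI xJ) orbT.
  by rewrite (level_arc_sub LJ LI le_ba xJ xI).
have eq_of_mem y : h a = h b -> y \in carc a m -> y \in carc b l -> carc a m = carc b l.
  move=> eq_ab yI yJ; apply/eqP.
  by rewrite eqEsubset (level_arc_sub LJ LI _ yJ yI) ?(level_arc_sub LI LJ _ yI yJ)
    ?eq_ab.
have [outI outJ] := (level_arc_out LI, level_arc_out LJ).
have [[_ _ _ geI] [_ _ _ geJ]] := (LI, LJ).
move=> sepI sepJ.
have bnd K c : sep x K -> out_below h c K -> (forall y, y \in K -> (c <= h y)%N) ->
    (x \in K /\ (h x = c /\ h (x + 1)%R < c)%N) \/
    (x + 1 \in K /\ (h (x + 1)%R = c /\ h x < c)%N).
  rewrite /sep => sepK outK geK; have := adm x.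
  case xK: (x \in K) sepK; case x1K: (x + 1 \in K) => // _ admx; [left|right];
    split=> //.
    have := geK _ xK; have := outK _ _ xK (negbT x1K) (or_introl erefl).
    by case: admx; lia.
  have := geK _ x1K; have := outK _ _ x1K (negbT xK) (or_intror erefl).
  by case: admx; lia.
have [[xI [e1 e2]]|[xI [e1 e2]]] := bnd (carc a m) (h a) sepI outI geI;
  have [[xJ [e3 e4]]|[xJ [e3 e4]]] := bnd (carc b l) (h b) sepJ outJ geJ; try lia.
  by apply: (eq_of_mem x) => //; lia.
by apply: (eq_of_mem (x + 1)) => //; lia.
Qed.

Lemma level_arcs_system h : odd n.+3 -> admissible h -> arc_system (level_arcs h).
Proof.
move=> oddN adm; have ncL := level_arcs_noncrossing adm; split=> // [I|a m j].
  case/level_arcsP=> a [m [[/andP[m_gt0 lt_m] ha1 ham geI] ->]].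
  exists a, m; split=> //.
  have pos x : x \in carc a m -> (0 < h x)%N by move=> /geI; lia.
  (* Leaving the arc takes the depth from [h a] to one less, so the [m] steps from [a] change the
     parity. *)
  have := odd_admissible adm lt_m pos (leqnn m).
  have := adm (a + m.-1%:R); rewrite -addrA natr1 prednK //.
  have : (h a <= h (a + m.-1%:R)%R)%N by apply: geI; rewrite arc_nat; lia.
  move: ham; move: (h a) (h (a + m%:R)) (h (a + m.-1%:R)) => p q r lt_qp le_pr.
  by case=> [||[]]; case: (odd m) => //=; rewrite addbF; lia.
move=> LI odd_m lt_m odd_j lt_j.
case/level_arcsP: (LI) => b [l [[rl hb1 hbl geI] defI]].
have [|a1I aI] := @arc_left a m; first by rewrite lt_m; case: (m) odd_m.
have eq_ba : b = a.
  have [_ bI] := arc_left b rl; rewrite -defI in bI.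
  have : sep (a - 1) (carc a m) by rewrite /sep subrK aI (negPf a1I).
  rewrite defI sep_arc // subrK => /orP[/eqP//|/eqP eq_a].
  by move: aI; rewrite defI eq_a arc_nat ?ltnn //; case/andP: rl.
rewrite -defI {}eq_ba in hb1 hbl geI.
have pos x : x \in carc a m -> (0 < h x)%N by move/geI; lia.
have lt_jN := ltn_trans lt_j lt_m.
(* At an odd offset the parity differs from that of [h a], so the depth is larger. The level arc one
   level up around this vertex avoids [a], hence is strictly smaller. *)
have lt_h : (h a < h (a + j%:R)%R)%N.
  have := odd_admissible adm lt_m pos (ltnW lt_j); rewrite odd_j addbT.
  have : (h a <= h (a + j%:R)%R)%N by apply: geI; rewrite arc_nat.
  by rewrite leq_eqVlt => /predU1P[->|//]; case: odd.
have [|c [k [Lck jJ hc]]] := @level_arc_ex h (h a).+1 (a + j%:R) oddN adm.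
  by rewrite lt_h.
have LJ : carc c k \in level_arcs h by apply/level_arcsP; exists c, k.
exists (carc c k); split=> //.
have ajI : a + j%:R \in carc a m by rewrite arc_nat.
have aJ : a \notin carc c k by apply/negP=> aJ; have [_ _ _ /(_ _ aJ)] := Lck;
  rewrite hc ltnn.
rewrite properE; apply/andP; split; last by apply/negP=> /subsetP/(_ a aI); apply/negP.
have /orP[//|/subsetP/(_ a aI) aJ'] := ncL.1 _ _ _ LJ LI jJ ajI.
by rewrite aJ' in aJ.
Qed.

(** Both functions vanish at a zero of [h] and change equally along each edge: where [h] rises or
    falls, the level arc around the deeper vertex ends, and no level arc meets depth 0. *)
Lemma mult_level_arcs h : odd n.+3 -> admissible h -> mult (level_arcs h) =1 h.
Proof.
move=> oddN adm; have ncL := level_arcs_noncrossing adm.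
have [z hz] := admissible_zero oddN adm.
have notin0 x I : h x = 0%N -> I \in level_arcs h -> x \notin I.
  move=> hx /level_arcsP[a [m [[_ ha1 _ geI] ->]]]; apply/negP=> /geI.
  by rewrite hx; lia.
apply: (cyc_ind (z := z)).
  rewrite hz; apply/eqP; rewrite cards_eq0; apply/eqP/setP=> I;
    rewrite [LHS]inE in_set0.
  by case LI: (I \in level_arcs h) => //=; apply/negbTE/(notin0 z).
move=> x IHx; case: (adm x) => [up|down|[hx hx1]].
- have [|a [m [Lam xI ha]]] := @level_arc_ex h (h (x + 1))%R (x + 1) oddN adm.
    by rewrite leqnn up.
  rewrite up -IHx; apply: (mult_up (I := carc a m)) => //.
    by apply/level_arcsP; exists a, m.
  by apply/negP=> yI; have [_ _ _ /(_ _ yI)] := Lam; rewrite ha up ltnn.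
- have [|a [m [Lam xI ha]]] := @level_arc_ex h (h x) x oddN adm.
    by rewrite leqnn down.
  apply/eqP; rewrite -eqSS -down -IHx; apply/eqP/esym.
  apply: (mult_down (I := carc a m)) => //.
    by apply/level_arcsP; exists a, m.
  by apply/negP=> yI; have [_ _ _ /(_ _ yI)] := Lam; rewrite ha down ltnn.
rewrite hx1 -hx -IHx; apply: mult_flat => I LI.
by rewrite /sep !(negPf (notin0 _ _ _ LI)).
Qed.

(** * Uniqueness and domination of depth functions *)

(** The coefficient in [eps] of a vertex of depth [d]; its values are 0, 1, 1, 0, repeating. *)
Definition tri_odd (d : nat) : bool := odd ((d * d.+1) %/ 2).

Lemma tri_oddS d : tri_odd d.+1 = tri_odd d (+) ~~ odd d.
Proof.
rewrite /tri_odd (_ : d.+1 * d.+2 = d * d.+1 + d.+1 * 2)%N; last by lia.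
by rewrite divnDMl // oddD.
Qed.

(* [zig] turns the local rule for an admissible h into the affine rule [zigD],
   of slope -1, which has at most one solution on an odd cycle. *)
Definition zig (d : nat) : int := if odd d then - (d.*2.+1)%:Z else (d.*2.+1)%:Z.

Lemma zig_inj : injective zig.
Proof. by move=> c d; rewrite /zig; case: (odd c); case: (odd d); lia. Qed.

Lemma zigD h x : admissible h ->
  zig (h x) + zig (h (x + 1)) =
    if tri_odd (h x) (+) tri_odd (h (x + 1)) then (-2) else 2.
Proof.
move=> /(_ x)[->|->|[-> ->]] //.
  by rewrite tri_oddS addKb /zig /=; case: (odd (h x)) => /=; lia.
by rewrite tri_oddS addbC addKb /zig /=; case: (odd (h (x + 1))) => /=; lia.
Qed.

(** The two classes may differ by a constant, which cancels when the vertices of an edge are added.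
    By [zigD] the difference of the [zig] values then changes sign at each step, so it vanishes on
    an odd cycle. *)
Lemma admissible_inj h h' : odd n.+3 -> admissible h -> admissible h' ->
    (forall x, tri_odd (h x) (+) tri_odd (h' x) =
               tri_odd (h (x + 1)) (+) tri_odd (h' (x + 1))) ->
  h =1 h'.
Proof.
move=> oddN adm adm' eq_tri x; apply: zig_inj; apply/eqP; rewrite -subr_eq0.
have /(cyc_odd_alt oddN)/(_ x) : forall x,
    zig (h (x + 1)) - zig (h' (x + 1)) = - (zig (h x) - zig (h' x)).
  move=> y; have := zigD y adm; have := zigD y adm'; move: (eq_tri y).
  case: (tri_odd (h y)); case: (tri_odd (h' y)); case: (tri_odd (h (y + 1)));
    by case: (tri_odd (h' (y + 1))) => //= _; lia.
by move/eqP; lia.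
Qed.

(** [switch true] is (0 1)(2 3)... and [switch false] is (1 2)(3 4)..., which fixes 0 because [0.-1]
    is 0. *)
Definition switch (b : bool) (d : nat) : nat := if b (+) odd d then d.+1 else d.-1.

Lemma switchK (c : bool) : involutive (switch c).
Proof.
move=> d; rewrite /switch; case cd: (c (+) odd d); first by rewrite /= addbN cd.
case: d cd => [|d] /=; first by rewrite addbF => ->.
by rewrite addbN => /negbFE ->.
Qed.

(** [tri_odd] differs on the pairs (0 1), (2 3), ... and agrees on the pairs (1 2), (3 4), ... *)
Lemma tri_odd_switch (b : bool) d : tri_odd (switch b d) = tri_odd d (+) b.
Proof.
rewrite /switch; case bd: (b (+) odd d).
  by rewrite tri_oddS; move: bd; case: b; case: (odd d).
case: d bd => [|d] /=; first by rewrite addbF => ->.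
by rewrite tri_oddS addbN => /negbFE; case: b; case: (odd d); case: (tri_odd d).
Qed.

Lemma switch_le (b : bool) d : (switch b d <= d.+1)%N.
Proof. by rewrite /switch; case: ifP => // _; lia. Qed.

(* The regions cut out by B form a tree, and crossing the boundary of I acts on
   the depth by the involution [switch (I \in A)]; so the smallest member of B
   may be treated last. *)
Lemma label_depth A B : noncrossing B -> A \subset B -> exists h : T -> nat,
  [/\ forall x, (h x <= mult B x)%N,
      forall x, tri_odd (h x) = odd (mult A x),
      forall x I, I \in B -> sep x I -> h (x + 1) = switch (I \in A) (h x) &
      forall x, (forall I, I \in B -> ~~ sep x I) -> h (x + 1) = h x].
Proof.
elim: {B}#|B| {-2}B (erefl #|B|) A => [|c IH] B cardB A ncB sAB.
  exists (fun=> 0%N); split=> // [x|x I]; last by rewrite (cards0_eq cardB) inE.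
  rewrite /mult eq_card0 // => I; rewrite !inE.
  case AI: (I \in A) => //=; have := subsetP sAB I AI.
  by rewrite (cards0_eq cardB) inE.
have /card_gt0P[I0 BI0] : (0 < #|B|)%N by rewrite cardB.
have [I /= BI minI] := @arg_minnP _ I0 [pred J | J \in B] (fun J : {set T} => #|J|) BI0.
have {I0 BI0} ncBI := noncrossing_sub (subD1set B I) ncB.
have cardBI : #|B :\ I| = c by apply/eqP; rewrite -eqSS -cardB (cardsD1 I B) BI.
have [h [h_le h_tri h_sep h_flat]] := IH (B :\ I) cardBI (A :\ I) ncBI (setSD _ sAB).
have multD1 C x : mult C x = ((I \in C) && (x \in I) + mult (C :\ I) x)%N.
  rewrite /mult (cardsD1 I) inE; congr (_ + _)%N; apply: eq_card => J.
  by rewrite !inE andbA.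
have noI x J : sep x I -> J \in B :\ I -> ~~ sep x J.
  move=> sepI; rewrite !inE => /andP[neJ BJ]; apply/negP=> sepJ.
  by case/eqP: neJ; apply: (ncB.2 J I x).
(* A member meeting the smallest member [I] contains it, so an edge on which another member ends has
   both vertices outside [I]. *)
have sepD1 x J : J \in B :\ I -> sep x J -> (x \in I = false) /\ (x + 1 \in I = false).
  move=> BIJ sepJ; have /andP[neJ BJ] : (J != I) && (J \in B) by rewrite !inE in BIJ.
  have nsep : ~~ sep x I by apply/negP=> /noI/(_ BIJ)/negP.
  have eqx : (x \in I) = (x + 1 \in I) by apply/eqP; rewrite -[_ == _]negbK.
  suff xI : x \in I = false by rewrite -eqx xI.
  apply/negbTE/negP=> xI; have sub y : y \in I -> y \in J -> I \subset J.
    move=> yI yJ; case/orP: (ncB.1 I J y BI BJ yI yJ) => // sJI.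
    by case/eqP: neJ; apply/eqP; rewrite eqEcard sJI minI.
  move: sepJ; rewrite /sep; case xJ: (x \in J); case x1J: (x + 1 \in J) => // _.
    by have := subsetP (sub x xI xJ) (x + 1); rewrite -eqx xI x1J => /(_ isT).
  by have := subsetP (sub (x + 1) _ x1J) x; rewrite -eqx xI xJ => /(_ isT isT).
(* Only the vertices of [I] are relabelled. As [switch] is an involution, entering and leaving [I]
   obey the same rule. *)
exists (fun x => if x \in I then switch (I \in A) (h x) else h x);
  split=> [x|x|x J BJ|x flat].
- rewrite (multD1 B) BI /=; case: (x \in I) => /=; last exact: h_le.
  by apply: leq_trans (switch_le _ _) _; rewrite add1n ltnS h_le.
- rewrite (multD1 A) oddD oddb; case: (x \in I); last by rewrite andbF h_tri.
  by rewrite tri_odd_switch h_tri andbT addbC.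
- have [-> sepI|neJ sepJ] := eqVneq J I.
    have hE : h (x + 1) = h x by apply: h_flat => K; apply: noI.
    by move: sepI; rewrite /sep hE; case: (x \in I); case: (x + 1 \in I);
      rewrite ?switchK.
  have BIJ : J \in B :\ I by rewrite !inE neJ.
  have [-> ->] := sepD1 x J BIJ sepJ.
  by rewrite (h_sep x J BIJ sepJ) !inE neJ.
have hE : h (x + 1) = h x by apply: h_flat => K; rewrite inE => /andP[_]; apply: flat.
by have := flat I BI; rewrite negbK hE => /eqP ->.
Qed.

(** Across an end, [switch] moves by 1 or fixes 0. Where no member ends, the depth of [B] is 0 by
    [mult_admissible], and so is [h] below it. *)
Lemma label_admissible A B : arc_system B -> A \subset B -> exists h : T -> nat,
  [/\ admissible h, forall x, (h x <= mult B x)%N &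
      forall x, tri_odd (h x) = odd (mult A x)].
Proof.
move=> sysB sAB; have [_ ncB _] := sysB.
have [h [h_le h_tri h_sep h_flat]] := label_depth ncB sAB.
exists h; split=> // x.
have [/existsP[I /andP[BI sepI]]|/existsPn flat] := boolP [exists I in B, sep x I].
  rewrite (h_sep x I BI sepI) /switch; case: ifP => _; first exact: Or31.
  by case: (h x) => [|d]; [apply: Or33|apply: Or32].
have {}flat I : I \in B -> ~~ sep x I by move=> BI; have := flat I; rewrite BI.
rewrite h_flat //; apply: Or33.
have m0 : mult B x = 0%N by case: (mult_admissible sysB x) => [||[]//];
  rewrite mult_flat //; lia.
by have := h_le x; rewrite m0 leqn0 => /eqP ->.
Qed.

(** * Injective walks on the cycle *)

Lemma walk_straight (p : nat -> T) (k : nat) :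
    (forall i, (i < k)%N -> p i.+1 = p i + 1 \/ p i = p i.+1 + 1) ->
    (forall i j, (i <= k)%N -> (j <= k)%N -> p i = p j -> i = j) ->
  (forall i, (i <= k)%N -> p i = p 0 + i%:R) \/
  (forall i, (i <= k)%N -> p i = p 0 - i%:R).
Proof.
elim: k => [|k IH] step inj; first by left=> i; rewrite leqn0 => /eqP->; rewrite addr0.
have {}IH := IH (fun i lt_i => step i (leqW lt_i))
                (fun i j le_i le_j => inj i j (leqW le_i) (leqW le_j)).
case: k => [|k] in step inj IH *.
  case: (step 0%N isT) => p1; [left|right]; case=> [|[|//]] _; rewrite ?addr0 ?subr0 //.
  by rewrite p1 addrK.
case: (step k.+1 (leqnn _)) IH => pk [IH|IH].
- left=> i; rewrite leq_eqVlt => /predU1P[->|/IH//].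
  by rewrite pk (IH k.+1) // -addrA natr1.
(* Turning back would revisit [p k]. *)
- have E : p k.+2 = p k
  by rewrite pk (IH k.+1) // (IH k) ?leqnSn // -[k.+1%:R]natr1 opprD addrA addrNK.
  by have := inj k.+2 k (leqnn _) (leqW (leqW (leqnn k))) E; lia.
- have E : p k.+2 = p k.
    by apply: (addIr 1); rewrite -pk (IH k.+1) // (IH k) ?leqnSn // -addrA natr1.
  by have := inj k.+2 k (leqnn _) (leqW (leqW (leqnn k))) E; lia.
right=> i; rewrite leq_eqVlt => /predU1P[->|/IH//].
by apply: (addIr 1); rewrite -pk (IH k.+1) // -[k.+2%:R]natr1 opprD addrA addrNK.
Qed.

Lemma walk_arc (p : nat -> T) (k : nat) : (k.+1 < n.+3)%N ->
    (forall i, (i < k)%N -> p i.+1 = p i + 1 \/ p i = p i.+1 + 1) ->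
    (forall i j, (i <= k)%N -> (j <= k)%N -> p i = p j -> i = j) ->
  exists a, forall x, x \in carc a k.+1 <-> exists2 i, (i <= k)%N & x = p i.
Proof.
move=> lt_k step inj; case: (walk_straight step inj) => pE.
  exists (p 0%N) => x; split=> [/arcP[i lt_i [_ ->]]|[i le_i ->]].
    by exists i => //; rewrite (pE i).
  by rewrite (pE i) // arc_nat // (leq_ltn_trans _ lt_k) // leqW.
(* For a descending walk the arc starts at the last vertex. *)
exists (p 0%N - k%:R) => x; split=> [/arcP[i lt_i [_ ->]]|[i le_i ->]].
  exists (k - i)%N; rewrite ?leq_subr // (pE (k - i)%N) ?leq_subr //.
  by rewrite (natrB _ (_ : i <= k)%N) // opprB addrA addrAC.
rewrite (pE i) // (_ : p 0%N - i%:R = p 0%N - k%:R + (k - i)%:R).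
  by rewrite arc_nat; lia.
by rewrite (natrB _ le_i) addrA addrNK.
Qed.

End Cycle.

(** * Linear combinations over F_2 *)

Lemma natr_F2 k : k%:R = (odd k)%:R :> 'F_2.
Proof.
by rewrite -{1}[k]odd_double_half natrD -mul2n natrM pchar_Zp // mul0r addr0.
Qed.

Section SpanF2.
Variables (V : vectType 'F_2) (I : eqType) (f : I -> V).

Lemma addvv_F2 (v : V) : v + v = 0.
Proof. by rewrite -mulr2n -scaler_nat pchar_Zp // scale0r. Qed.

Lemma mulrn_F2 (v : V) k : v *+ k = (odd k)%:R *: v.
Proof. by rewrite -natr_F2 scaler_nat. Qed.

(** The only scalars are 0 and 1, so a linear combination is a subsum. *)
Lemma span_map_F2 (s : seq I) v : v \in <<map f s>>%VS ->
  exists2 s', subseq s' s & v = \sum_(x <- s') f x.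
Proof.
elim: s v => [|x s IH] v /=.
  by rewrite span_nil memv0 => /eqP->; exists [::] => //; rewrite big_nil.
rewrite span_cons => /memv_addP[_ /vlineP[k ->] [w /IH[s' ss' ->] ->]].
have [->|->] : k = 0 \/ k = 1.
  by case: k => -[|[|//]] ? /=; [left|right]; apply: val_inj.
  exists s'; last by rewrite scale0r add0r.
  exact: subseq_trans ss' (subseq_cons _ _).
by exists (x :: s'); rewrite ?big_cons ?scale1r //= eqxx.
Qed.

Lemma free_map_F2 (s : seq I) :
  (forall s', subseq s' s -> \sum_(x <- s') f x = 0 -> s' = [::]) -> free (map f s).
Proof.
elim: s => [|x s IH] indep /=; first exact: nil_free.
rewrite free_cons IH ?andbT => [|s' ss']; last first.
  by apply: indep; apply: subseq_trans ss' (subseq_cons _ _).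
apply/negP=> /span_map_F2[s' ss' fx].
by have := indep (x :: s'); rewrite big_cons -fx addvv_F2 /= eqxx => /(_ ss' erefl).
Qed.

End SpanF2.

(* A consists of the members at odd depth: a chain of d sets has uphalf d of
   them, and uphalf d has the parity of d (d + 1) / 2. *)
Lemma laminar_tri_odd (U : finType) (B : {set {set U}}) :
    (forall X Y s, X \in B -> Y \in B -> s \in X -> s \in Y ->
       (X \subset Y) || (Y \subset X)) ->
  exists2 A : {set {set U}}, A \subset B &
    forall s, tri_odd (mult B s) = odd (mult A s).
Proof.
elim: {B}#|B| {-2}B (erefl #|B|) => [|c IH] B cardB lam.
  exists B => // s; rewrite /mult eq_card0 // => X.
  by rewrite !inE (cards0_eq cardB) inE.
have /card_gt0P[X0 BX0] : (0 < #|B|)%N by rewrite cardB.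
have [X /= BX minX] := @arg_minnP _ X0 [pred X | X \in B] (fun X : {set U} => #|X|) BX0.
have cardBX : #|B :\ X| = c by apply/eqP; rewrite -eqSS -cardB (cardsD1 X B) BX.
have [|A sAB triA] := IH (B :\ X) cardBX.
  by move=> Y Z s; rewrite !inE => /andP[_ BY] /andP[_ BZ]; apply: lam.
have multD1 C s : mult C s = ((X \in C) && (s \in X) + mult (C :\ X) s)%N.
  rewrite /mult (cardsD1 X) inE; congr (_ + _)%N; apply: eq_card => Y.
  by rewrite !inE andbA.
have sAB' : A \subset B by apply: subset_trans sAB (subD1set _ _).
have XA : X \notin A by apply/negP=> /(subsetP sAB); rewrite !inE eqxx.
have AX : A :\ X = A by apply/setDidPl; rewrite disjoint_sym disjoints1.
(* Members that meet the smallest set [X] contain it, so all its points have depth [k + 1]; [X]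
   joins [A] exactly when [k] is even. *)
pose k := #|[set Y in B :\ X | X \subset Y]|.
have multk s : s \in X -> mult (B :\ X) s = k.
  move=> sX; apply: eq_card => Y; rewrite !inE; case neYX: (Y != X) => //=.
  case BY: (Y \in B) => //=; apply/idP/idP => [sY|/subsetP/(_ s sX)//].
  case/orP: (lam X Y s BX BY sX sY) => // sYX.
  by move: neYX; rewrite eqEcard sYX (minX Y BY).
case odd_k: (odd k).
  exists A => // s; rewrite multD1 BX /=; case sX: (s \in X); last by rewrite triA.
  by rewrite -triA add1n tri_oddS multk // odd_k addbF.
exists (X |: A); first by rewrite subUset sub1set BX.
move=> s; rewrite multD1 (multD1 (X |: A)) BX setU11 setU1K //.
case sX: (s \in X) => /=; last by rewrite triA.
by rewrite add1n tri_oddS multk // odd_k -(multk s sX) triA addbT.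
Qed.

(** * Families of odd paths as arc systems *)

Section Transfer.
Variables (V : vectType 'F_2) (form : {biscalar V}) (S : finType) (e : S -> V).
Variables (n : nat) (pos : S -> 'I_n.+3).
Hypothesis oddN : odd n.+3.
Hypothesis pos_inj : injective pos.
Hypothesis edgeE : forall s t,
  edge form e s t = (pos t == pos s + 1) || (pos s == pos t + 1).
Local Notation T := 'I_n.+3.
Local Notation g := (edge form e).
Implicit Types (s t u : S) (X Y Z W : {set S}) (A B : {set {set S}}) (a x : T).

(** * Connectedness of vertex sets, seen on the cycle *)

Lemma edge_sym s t : g s t = g t s.
Proof. by rewrite !edgeE orbC. Qed.

Lemma mem_pos X s : (pos s \in pos @: X) = (s \in X).
Proof. exact: mem_imset. Qed.

Lemma disconnectedI (J W : {set S}) s t : s \in W -> s \in J -> t \in J -> t \notin W ->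
    (forall u v, u \in W -> v \in J -> g u v -> v \in W) ->
  disconnected g J.
Proof.
move=> sW sJ tJ tW clW; apply/existsP; exists s; rewrite sJ; apply/existsP; exists t.
rewrite tJ; apply/negP=> /connectP[p]; elim: p s sW {sJ} => [|u p IH] s sW /=.
  by move=> _ def_t; rewrite def_t sW in tW.
by case/andP=> /and3P[_ uJ gsu] pp; apply: IH => //; apply: clW gsu.
Qed.

Lemma arc_connected X a m : pos @: X = carc a m ->
  forall s t, s \in X -> t \in X -> connect (induced g X) s t.
Proof.
move=> defX s t sX tX.
(* [P] reaches vertices of the cycle through preimages, so that [arc_connect] applies although [pos]
   need not be onto. *)
pose P x := exists2 u, u \in X & pos u = x /\ connect (induced g X) s u.
have PS u v : u \in X -> v \in X -> g u v -> connect (induced g X) s u -> P (pos v).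
  move=> uX vX guv su; exists v => //; split=> //; apply: connect_trans su (connect1 _).
  by rewrite /induced /= uX vX.
suff [u uX [/pos_inj <- //]] : P (pos t).
apply: (@arc_connect _ a m P _ (pos s)); rewrite -?defX ?mem_pos //; last by exists s.
move=> _ /imsetP[u uX ->] /imsetP[v vX defv]; rewrite defv.
split=> [] [w wX [/pos_inj eq_w sw]]; rewrite {}eq_w in sw.
  by apply: (PS u) => //; rewrite edgeE -defv eqxx.
by apply: (PS v) => //; rewrite edgeE -defv eqxx orbT.
Qed.

Lemma arc_not_disconnected X a m : pos @: X = carc a m -> ~~ disconnected g X.
Proof.
move=> defX; apply/existsP=> [[s /andP[sX /existsP[t /andP[tX]]]]].
by rewrite (arc_connected defX).
Qed.

Lemma card_pos X : #|pos @: X| = #|X|.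
Proof. exact: card_imset. Qed.

Lemma pos_preim (I : {set T}) : I \subset codom pos -> pos @: (pos @^-1: I) = I.
Proof.
move=> sI; apply/setP=> x; apply/imsetP/idP => [[s + ->]|xI]; first by rewrite inE.
by have /codomP[s def_x] := subsetP sI x xI; exists s; rewrite // inE -def_x.
Qed.

Lemma pos_sub_codom X : pos @: X \subset codom pos.
Proof. by apply/subsetP=> _ /imsetP[s _ ->]; apply: codom_f. Qed.


(** A path is an injective walk on the cycle, hence goes straight. Conversely, the offsets number
    the vertices of an arc as a path. *)
Lemma opathsP X : reflect (oarc (pos @: X)) (X \in opaths form e).
Proof.
apply: (iffP idP) => [|[a [m [odd_m lt_m defX]]]].
  rewrite !inE => /andP[/andP[X_gt0 /existsP[f /and3P[/injectiveP f_inj /eqP defX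
    /forallP fE]]] oddX].
  have leX : (#|X| <= n.+3)%N by have := max_card (mem (pos @: X));
    rewrite card_ord card_pos.
  have [k defk] : exists k, #|X| = k.+1 by case: #|X| X_gt0 => // k; exists k.
  move: f f_inj defX fE; rewrite {}defk in X_gt0 oddX leX *.
  move=> f f_inj defX fE; pose p i := pos (f (inord i)).
  have fE' i j : (i <= k)%N -> (j <= k)%N ->
      (p j == p i + 1) || (p i == p j + 1) = (i.+1 == j)%N || (j.+1 == i)%N.
    move=> le_i le_j; have /forallP/(_ (inord j))/eqP := fE (inord i).
    by rewrite edgeE /path_rel /= !inordK.
  have step i : (i < k)%N -> p i.+1 = p i + 1 \/ p i = p i.+1 + 1.
    move=> lt_i; have := fE' i i.+1 (ltnW lt_i) lt_i.
    by rewrite eqxx => /orP[]/eqP; [left|right].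
  have p_inj i j : (i <= k)%N -> (j <= k)%N -> p i = p j -> i = j.
    by move=> le_i le_j /pos_inj/f_inj/(congr1 val); rewrite /= !inordK.
  (* A straight walk through all N vertices would have adjacent ends, unlike a path on at least 3
     vertices. *)
  have lt_k : (k.+1 < n.+3)%N.
    rewrite ltn_neqAle leX andbT; apply/eqP=> -[eq_k].
    have := fE' 0%N k isT (leqnn k).
    have kN : k%:R = -1 :> T by apply: (addIr 1); rewrite natr1 eq_k cyc_natr addNr.
    have [pE|pE] := walk_straight step p_inj; rewrite pE // kN.
      by rewrite addrNK eqxx orbT eq_k.
    by rewrite opprK eqxx eq_k.
  have [a defa] := walk_arc lt_k step p_inj.
  exists a, k.+1; split=> //; apply/setP=> x; apply/imsetP/idP.
    case=> s; rewrite -defX => /imsetP[i _ ->] ->; apply/defa.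
    by exists (val i); [rewrite -ltnS; apply: ltn_ord | rewrite /p inord_val].
  by case/defa=> i le_i ->; exists (f (inord i)); rewrite // -defX imset_f.
have cardX : #|X| = m by rewrite -card_pos defX card_arc // ltnW.
have m_gt0 : (0 < m)%N by case: (m) odd_m.
rewrite !inE cardX m_gt0 odd_m andbT /=.
have /card_gt0P[s0 _] : (0 < #|X|)%N by rewrite cardX.
pose inv x := odflt s0 [pick s | pos s == x].
have invE x : x \in carc a m -> pos (inv x) = x.
  rewrite -defX /inv => /imsetP[s _ ->].
  by case: pickP => [t /eqP //|/(_ s)]; rewrite eqxx.
have lt_i (i : 'I_m) : (i < n.+3)%N by apply: ltn_trans lt_m.
have arc_i (i : 'I_m) : a + (i : nat)%:R \in carc a m by rewrite arc_nat ?ltn_ord.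
have nat_inj i j : (i < n.+3)%N -> (j < n.+3)%N -> (i%:R == j%:R :> T) = (i == j).
  by move=> Ni Nj; rewrite -[LHS](inj_eq (@ord_inj _)) !val_cyc_nat.
apply/existsP; exists [ffun i : 'I_m => inv (a + (i : nat)%:R)]; apply/and3P; split.
- apply/injectiveP=> i j; rewrite !ffunE => /(congr1 pos); rewrite !invE //.
  by move/addrI/eqP; rewrite nat_inj // => /eqP/val_inj.
- apply/eqP/setP=> s; apply/imsetP/idP => [[i _ ->]|sX].
    by rewrite ffunE -mem_pos defX invE.
  have : pos s \in carc a m by rewrite -defX mem_pos.
  case/arcP=> i lt_im [_ pos_s]; exists (Ordinal lt_im) => //.
  by apply: pos_inj; rewrite ffunE /= -pos_s invE // -defX mem_pos.
apply/forallP=> i; apply/forallP=> j; apply/eqP.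
rewrite !ffunE edgeE !invE // -!addrA !natr1 ![a + _ == _](inj_eq (addrI a)).
by rewrite !nat_inj ?(leq_ltn_trans (ltn_ord _)) // eq_sym [in X in _ || X]eq_sym.
Qed.

(** * The relations between odd paths and the set I^ev in terms of arcs *)

Lemma opaths_arc X : X \in opaths form e ->
  exists a m, [/\ odd m, (m < n.+3)%N & pos @: X = carc a m].
Proof. by move/opathsP. Qed.

(** Each path is connected, so the union of two disjoint ones is disconnected exactly when no edge
    joins them. *)
Lemma spadeP X Y : X \in opaths form e -> Y \in opaths form e ->
  spade form e X Y <->
    [disjoint X & Y] /\ forall s t, s \in X -> t \in Y -> ~~ g s t.
Proof.
move=> pX pY; have [a [m [odd_m lt_m defX]]] := opaths_arc pX.
have [b [l [odd_l lt_l defY]]] := opaths_arc pY.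
split=> [/andP[dXY disc]|[dXY noE]]; [split=> //|apply/andP; split=> //].
  move=> s t sX tY; apply/negP=> gst; move: disc.
  case/existsP=> u /andP[uXY /existsP[v /andP[vXY /negP[]]]].
  have subC (Z : {set S}) : Z \subset X :|: Y ->
      subrel (connect (induced g Z)) (connect (induced g (X :|: Y))).
    move=> sZ; apply: connect_sub => w z /= /and3P[wZ zZ gwz]; apply: connect1.
    by rewrite /induced /= !(subsetP sZ).
  have CX w z : w \in X -> z \in X -> connect (induced g (X :|: Y)) w z.
    by move=> wX zX; apply: (subC X (subsetUl _ _)); apply: arc_connected defX _ _ _ _.
  have CY w z : w \in Y -> z \in Y -> connect (induced g (X :|: Y)) w z.
    by move=> wY zY; apply: (subC Y (subsetUr _ _)); apply: arc_connected defY _ _ _ _.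
  have Cst : connect (induced g (X :|: Y)) s t.
    by apply: connect1; rewrite /induced /= !inE sX tY orbT.
  have Cts : connect (induced g (X :|: Y)) t s.
    by apply: connect1; rewrite /induced /= !inE sX tY orbT edge_sym.
  case/setUP: uXY => [uX|uY]; case/setUP: vXY => [vX|vY].
  - exact: CX.
  - exact: connect_trans (CX _ _ uX sX) (connect_trans Cst (CY _ _ tY vY)).
  - exact: connect_trans (CY _ _ uY tY) (connect_trans Cts (CX _ _ sX vX)).
  - exact: CY.
have gt0 (Z : {set S}) c k : pos @: Z = carc c k -> odd k -> (k < n.+3)%N -> exists s,
  s \in Z.
  move=> defZ odd_k lt_k; apply/card_gt0P; rewrite -card_pos defZ card_arc;
    last exact: ltnW.
  by case: (k) odd_k.
have [s sX] := gt0 _ _ _ defX odd_m lt_m; have [t tY] := gt0 _ _ _ defY odd_l lt_l.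
apply: (disconnectedI sX (t := t)); rewrite ?inE ?sX ?tY ?orbT //.
  by rewrite disjoint_sym in dXY; rewrite (disjointFr dXY).
by move=> u v uX /setUP[//|vY] guv; have := noE u v uX vY; rewrite guv.
Qed.

(** Removing a smaller arc from an arc leaves a single arc if they share an end, and two separated
    pieces otherwise. *)
Lemma precP X Y : X \in opaths form e -> Y \in opaths form e ->
  prec form e X Y <->
    X \proper Y /\ forall x, sep x (pos @: X) -> ~~ sep x (pos @: Y).
Proof.
move=> pX pY; have [a [m [odd_m lt_m defX]]] := opaths_arc pX.
have [b [l [odd_l lt_l defY]]] := opaths_arc pY.
have rm : (0 < m < n.+3)%N by rewrite lt_m; case: (m) odd_m.
have rl : (0 < l < n.+3)%N by rewrite lt_l; case: (l) odd_l.
have [a1X aX] := arc_left a rm; have [b1Y bY] := arc_left b rl.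
split=> [/andP[ltXY disc]|[ltXY noSep]]; [split=> //|apply/andP; split=> //].
  have sXY : carc a m \subset carc b l by rewrite -defX -defY imsetS // proper_sub.
  have le_ml : (m <= l)%N.
    by rewrite -(card_arc a (ltnW lt_m)) -(card_arc b (ltnW lt_l)) subset_leq_card.
  have posD : pos @: (Y :\: X) = carc b l :\: carc a m.
    apply/setP=> x; rewrite inE -defX -defY; apply/imsetP/andP => [[s]|[xX]].
      by rewrite inE => /andP[sX sY] ->; rewrite !mem_pos.
    by case/imsetP=> s sY def_x; exists s; rewrite // inE sY -mem_pos -def_x xX.
  move=> x; rewrite defX defY => sepX; apply/negP=> sepY.
  suff [c [k defD]] : exists c k, carc b l :\: carc a m = carc c k.
    by move: disc; apply/negP; apply: (arc_not_disconnected (a := c) (m := k));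
      rewrite posD.
  move: (sepX) (sepY); rewrite /sep; case xX: (x \in carc a m);
    case x1X: (_ \in _) => // _;
    case xY: (x \in carc b l); case x1Y: (_ \in _) => // _.
  (* Common right end: the initial piece of [Y] remains. *)
  - exists b, (l - m)%N.
    have : x + 1 = a + m%:R.
      move: sepX; rewrite sep_arc // => /orP[]/eqP // xa.
      by rewrite xa aX in x1X.
    have : x + 1 = b + l%:R.
      move: sepY; rewrite sep_arc // => /orP[]/eqP // xb.
      by rewrite xb bY in x1Y.
    move=> -> /eqP; rewrite -subr_eq => /eqP eq_a.
    have {}eq_a : a = b + (l - m)%:R by rewrite natrB // addrA.
    apply/setP=> y; rewrite in_setD !mem_arc eq_a opprD addrA val_cycB; last first.
      exact: leq_ltn_trans (leq_subr _ _) lt_l.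
    have := ltn_ord (y - b); move: (nat_of_ord (y - b)) => i lt_i.
    move: le_ml lt_l lt_i; clear => le_ml lt_l lt_i.
    by apply/idP/idP; case: (leqP (l - m) i) => ?; nat_lia.
  - by have := subsetP sXY x xX; rewrite xY.
  - by have := subsetP sXY _ x1X; rewrite x1Y.
  (* Common left end: the final piece remains. *)
  exists (a + m%:R), (l - m)%N; rewrite -arcD //; suff -> : a = b by [].
  move: sepX sepY; rewrite !sep_arc // => /orP[]/eqP xa.
    move=> /orP[]/eqP xb; first by rewrite -xa xb.
    by move: x1Y; rewrite xb arc_nat ?ltnn.
  by move: x1X; rewrite xa arc_nat ?ltnn.
have sXY : carc a m \subset carc b l by rewrite -defX -defY imsetS // proper_sub.
have neq_ab : a != b.
  apply/eqP=> eq_ab; have := noSep (a - 1);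
    rewrite defX defY /sep !subrK aX (negPf a1X).
  by rewrite eq_ab bY (negPf b1Y) => /(_ isT).
have a1Y : a - 1 \in carc b l.
  have := noSep (a - 1); rewrite defX defY /sep !subrK aX (negPf a1X) => /(_ isT).
  by rewrite negbK (subsetP sXY a aX) => /eqP.
have amX : a + m%:R \notin carc a m by rewrite arc_nat ?ltnn.
have amY : a + m%:R \in carc b l.
  have am : a + m.-1%:R + 1 = a + m%:R by rewrite -addrA natr1 prednK //; case/andP: rm.
  have am1X : a + m.-1%:R \in carc a m by rewrite arc_nat; nat_lia.
  have := noSep (a + m.-1%:R); rewrite defX defY /sep am am1X (negPf amX) => /(_ isT).
  by rewrite negbK (subsetP sXY _ am1X) => /eqP.
have /imsetP[s0 s0Y pos_s0] : a - 1 \in pos @: Y by rewrite defY.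
have /imsetP[t0 t0Y pos_t0] : a + m%:R \in pos @: Y by rewrite defY.
pose v := nat_of_ord (a - b); have lt_v : (v < n.+3)%N := ltn_ord _.
have v_gt0 : (0 < v)%N.
  by rewrite lt0n; apply: contra neq_ab => /eqP v0; rewrite -subr_eq0;
    apply/eqP/val_inj.
have def_a : a = b + v%:R by rewrite natr_Zp addrC subrK.
(* Otherwise [X] would run on to [b - 1], which is outside [Y]. So the vertex past [X] has offset
   [v + m] from [b]. *)
have le_vm : (v + m < n.+3)%N.
  rewrite ltnNge; apply/negP=> ge_vm; case/negP: b1Y; apply: (subsetP sXY).
  have -> : b - 1 = a + (n.+3 - v).-1%:R.
    rewrite def_a -addrA -natrD -[b - 1]addr0; apply: (addIr 1).
    rewrite addr0 addrNK -addrA natr1 -addnS prednK ?subn_gt0 // subnKC 1?ltnW //.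
    by rewrite cyc_natr addr0.
  by rewrite arc_nat; nat_lia.
(* The piece of [Y] before [X]; it contains [s0], misses [t0], and is closed under edges avoiding
   [X]. *)
pose W := [set s in Y | ((pos s - b)%R < v)%N].
have offY s : s \in Y -> ((pos s - b)%R < l)%N by rewrite -mem_pos defY mem_arc.
have offS s : (pos s + 1 - b : T) =
    (if (pos s - b)%R.+1 == n.+3 then 0%N else (pos s - b)%R.+1) :> nat.
  by rewrite addrAC val_cycD1.
apply: (disconnectedI (W := W) (s := s0) (t := t0)).
- by rewrite inE s0Y -pos_s0 addrAC val_cycB1 -/v; case: eqP; nat_lia.
- by rewrite inE s0Y -mem_pos -pos_s0 defX a1X.
- by rewrite inE t0Y -mem_pos -pos_t0 defX amX.
- by rewrite inE t0Y -pos_t0 def_a addrAC [b + _]addrC addrK -natrD val_cyc_nat //=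
  -leqNgt leq_addr.
move=> s t; rewrite !inE => /andP[sY lt_s] /andP[tX tY]; rewrite tY edgeE andTb.
have lt_sl := offY s sY; have lt_tl := offY t tY.
case/orP=> /eqP pos_t; last by have := offS t; rewrite -pos_t; case: eqP; nat_lia.
have := offS s; rewrite -pos_t; have ne_v : (pos t - b)%R != v :> nat.
  apply: contra tX => /eqP pos_v; rewrite -mem_pos defX.
  suff -> : pos t = a by [].
  by rewrite def_a -pos_v natr_Zp addrC subrK.
by move: ne_v; case: (_ =P n.+3); nat_lia.
Qed.

(** Removing the vertex at offset d leaves pieces of d and [m] - 1 - d vertices; as [m] is odd, both
    are odd exactly when d is. *)
Lemma ev_pos X a m s : X \in opaths form e -> pos @: X = carc a m -> (m < n.+3)%N ->
  odd m -> s \in X -> (s \in ev form e X) = odd (pos s - a)%R.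
Proof.
move=> pX defX lt_m odd_m sX; pose d t := nat_of_ord (pos t - a)%R.
have memX t : (t \in X) = (d t < m)%N by rewrite -mem_pos defX mem_arc.
have lt_d t : (d t < n.+3)%N by apply: ltn_ord.
have d_inj t u : d t = d u -> t = u by move/ord_inj/addIr/pos_inj.
have edge_d t u : d t = (d u).+1 -> g t u.
  move=> dt; suff pos_t : pos t = pos u + 1 by rewrite edgeE pos_t eqxx orbT.
  apply: (addIr (- a)); apply: ord_inj; rewrite [pos u + 1 - a]addrAC val_cycD1.
  rewrite -/(d u) -/(d t) dt.
  by case: eqP => // eN; have := lt_d t; rewrite dt eN ltnn.
have d_edge t u : t \in X -> u \in X -> g t u -> d t = (d u).+1 \/ d u = (d t).+1.
  have step v w : v \in X -> w \in X -> pos w = pos v + 1 -> d w = (d v).+1.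
    move=> vX wX pos_w; rewrite /d pos_w addrAC val_cycD1 -/(d v).
    by case: eqP => // eN; move: vX; rewrite memX; nat_lia.
  by move=> tX uX; rewrite edgeE => /orP[]/eqP pos_; [right|left]; apply: step.
rewrite -/(d s); apply/idP/idP => [|odd_d].
  rewrite inE sX /= => /exists_inP[Y pY /exists_inP[Z pZ /andP[/eqP defXs spYZ]]].
  have [c [k [odd_k lt_k defY]]] := opaths_arc pY.
  have [b [l [odd_l lt_l defZ]]] := opaths_arc pZ.
  have [dYZ noE] := (spadeP pY pZ).1 spYZ.
  have discYZ : disconnected g (Y :|: Z) by case/andP: spYZ.
  (* The side of [s] on which [t] lies. A connected set missing [s] stays on one side, because
     adjacent offsets differ by 1. *)
  pose col t := (d t < d s)%N.
  have colP W c' k' : W \subset X :\ s -> pos @: W = carc c' k' ->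
      forall t u, t \in W -> u \in W -> col t = col u.
    move=> sW defW; suff main t u : t \in W -> u \in W -> col t -> col u.
      by move=> t u tW uW; apply/idP/idP; apply: main.
    move=> tW uW; have := arc_connected defW tW uW; case/connectP=> p.
    elim: p t {tW} => [|v p IH] t /=; first by move=> _ ->.
    case/andP=> /and3P[tW vW gtv] pp lastp ct; apply: (IH v) => //.
    have /setD1P[nvs vX] := subsetP sW v vW.
    have /setD1P[nts tX] := subsetP sW t tW.
    have ne_d : d v != d s by apply: contra nvs => /eqP/d_inj->.
    by move: ct ne_d; rewrite /col; case: (d_edge t v tX vX gtv) => ->; nat_lia.
  have sY : Y \subset X :\ s by rewrite defXs subsetUl.
  have sZ : Z \subset X :\ s by rewrite defXs subsetUr.
  have gt0 W c' k' : pos @: W = carc c' k' -> odd k' -> (k' < n.+3)%N -> exists t,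
    t \in W.
    move=> defW odd_k' lt_k'; apply/card_gt0P; rewrite -card_pos defW card_arc;
      last exact: ltnW.
    by case: (k') odd_k'.
  have [y yY] := gt0 _ _ _ defY odd_k lt_k; have [z zZ] := gt0 _ _ _ defZ odd_l lt_l.
  have ds_lt : (d s < m)%N by rewrite -memX.
  have pos_left W : (forall t, (t \in W) = (t \in X :\ s) && col t) ->
    pos @: W = carc a (d s).
    move=> defW; apply/setP=> x; apply/imsetP/idP => [[t + ->]|xa].
      by rewrite defW mem_arc => /andP[].
    have : x \in pos @: X by rewrite defX mem_arc (ltn_trans _ ds_lt) // -mem_arc.
    case/imsetP=> t tX def_x; exists t => //; rewrite defW in_setD1 tX andbT.
    rewrite /col; move: xa; rewrite mem_arc def_x -/(d t) => lt_t; rewrite lt_t andbT.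
    by apply/eqP=> ts; rewrite ts ltnn in lt_t.
  have odd_left W : W \in opaths form e ->
      (forall t, (t \in W) = (t \in X :\ s) && col t) -> odd (d s).
    move=> pW /pos_left defW; have: odd #|W| by move: pW; rewrite !inE => /andP[].
    by rewrite -card_pos defW card_arc // ltnW // (ltn_trans ds_lt).
  have memYZ t : (t \in X :\ s) = (t \in Y) || (t \in Z) by rewrite defXs inE.
  have colY t : t \in Y -> col t = col y by move=> tY; apply: colP sY defY _ _ _ _.
  have colZ t : t \in Z -> col t = col z by move=> tZ; apply: colP sZ defZ _ _ _ _.
  (* On the same side, [Y] and [Z] would together form one arc, which is connected. On different
     sides, one of them is the left piece, of odd size [d s]. *)
  case cy: (col y); case cz: (col z).
  - suff : ~~ disconnected g (Y :|: Z) by rewrite discYZ.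
    apply: (arc_not_disconnected (a := a) (m := d s)).
    apply: pos_left => t; rewrite -defXs; case tXs: (t \in X :\ s) => //=.
    by move: tXs; rewrite memYZ => /orP[/colY|/colZ] ->; rewrite ?cy ?cz.
  - apply: (odd_left Y pY) => t; rewrite memYZ.
    case tY: (t \in Y); first by rewrite colY.
    by case tZ: (t \in Z) => //=; rewrite colZ.
  - apply: (odd_left Z pZ) => t; rewrite memYZ.
    case tZ: (t \in Z); first by rewrite colZ // cz orbT.
    by case tY: (t \in Y) => //=; rewrite colY.
  suff : ~~ disconnected g (Y :|: Z) by rewrite discYZ.
  apply: (arc_not_disconnected (a := a + (d s).+1%:R) (m := (m - (d s).+1)%N)).
  rewrite -arcD //; apply/setP=> x; rewrite inE -defX.
  apply/imsetP/andP => [[t + ->]|[x_ge]].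
    rewrite -defXs => tXs; have /setD1P[nts tX] := tXs.
    rewrite mem_arc mem_pos tX -/(d t) ltnS -ltnNge; split=> //.
    rewrite ltn_neqAle [d s == _]eq_sym (contra _ nts) => [|/eqP/d_inj-> //].
    rewrite leqNgt -/(col t); move: tXs; rewrite memYZ.
    by case/orP=> [/colY|/colZ] ->; rewrite ?cy ?cz.
  case/imsetP=> t tX def_x; exists t => //; rewrite -defXs !inE tX andbT.
  by apply: contraNneq x_ge => ts; rewrite def_x ts mem_arc -/(d s) ltnS.
rewrite inE sX /=; pose Y := [set t in X | (d t < d s)%N]; pose Z :=
  [set t in X | (d s < d t)%N].
have ds_lt : (d s < m)%N by rewrite -memX.
have defY : pos @: Y = carc a (d s).
  apply/setP=> x; apply/imsetP/idP => [[t + ->]|xa].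
    by rewrite inE mem_arc => /andP[].
  have : x \in pos @: X by rewrite defX mem_arc (ltn_trans _ ds_lt) // -mem_arc.
  case/imsetP=> t tX def_x; exists t => //; rewrite inE tX.
  by move: xa; rewrite mem_arc def_x.
have defZ : pos @: Z = carc (a + (d s).+1%:R) (m - (d s).+1).
  rewrite -arcD //; apply/setP=> x; rewrite inE -defX.
  apply/imsetP/andP => [[t + ->]|[x_ge]].
    by rewrite inE => /andP[tX lt_t]; rewrite mem_arc mem_pos tX -/(d t) ltnS -ltnNge.
  case/imsetP=> t tX def_x; exists t => //; rewrite inE tX.
  by move: x_ge; rewrite mem_arc def_x -/(d t) ltnS -ltnNge.
have pY : Y \in opaths form e.
  by apply/opathsP; exists a, (d s); split=> //; apply: ltn_trans lt_m.
have pZ : Z \in opaths form e.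
  apply/opathsP; exists (a + (d s).+1%:R), (m - (d s).+1)%N.
  by rewrite oddB //= odd_m odd_d (leq_ltn_trans (leq_subr _ _)).
apply/exists_inP; exists Y => //; apply/exists_inP; exists Z => //; apply/andP; split.
  apply/eqP/setP=> t; rewrite !inE -andb_orr -neq_ltn andbC; congr (_ && ~~ _).
  by apply/eqP/eqP => [->|/d_inj].
apply/(spadeP pY pZ); split.
  by rewrite -setI_eq0; apply/eqP/setP=> t; rewrite !inE; nat_lia.
move=> t u; rewrite !inE => /andP[tX lt_t] /andP[uX lt_u]; apply/negP.
by case/(d_edge t u tX uX) => eq_d; nat_lia.
Qed.

(** * Families in phi(V) correspond to arc systems *)

Definition imgs B : {set {set T}} := [set pos @: X | X : {set S} in B].

Lemma mem_imgs X B : (pos @: X \in imgs B) = (X \in B).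
Proof. by apply: mem_imset; apply: imset_inj. Qed.

Lemma mult_imgs B s : mult (imgs B) (pos s) = mult B s.
Proof.
rewrite /mult -(card_imset _ (imset_inj pos_inj)); apply: eq_card => I.
rewrite inE; apply/andP/imsetP => [[/imsetP[X BX ->]]|[X]].
  by rewrite mem_pos => sX; exists X; rewrite // inE BX.
by rewrite inE => /andP[BX sX] ->; rewrite mem_imgs mem_pos.
Qed.

Lemma mult_imgs0 B x : x \notin codom pos -> mult (imgs B) x = 0%N.
Proof.
move=> xpos; apply: eq_card0 => I; rewrite !inE; apply/negP=> /andP[/imsetP[X _ ->]].
by move/(subsetP (pos_sub_codom X)); apply/negP.
Qed.

Lemma imset_sub_pos X Y : (pos @: X \subset pos @: Y) = (X \subset Y).
Proof.
apply/idP/idP => [/subsetP sXY|]; last exact: imsetS.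
by apply/subsetP=> t tX; rewrite -mem_pos sXY ?mem_pos.
Qed.

Lemma properim X Y : (pos @: X \proper pos @: Y) = (X \proper Y).
Proof. by rewrite !properE !imset_sub_pos. Qed.

(** Strictly nested members share no end by [precP]; disjoint ones sharing an end would be joined by
    an edge, against [spadeP]. By [ev_pos], (P_1) speaks of the odd offsets. *)
Lemma phi_arc_system B : B \in phi form e -> arc_system (imgs B).
Proof.
rewrite inE => /and3P[/subsetP pB /forall_inP P0B /forall_inP P1B]; split.
- by move=> _ /imsetP[X BX ->]; apply/opathsP/pB.
- have cases X Y : X \in B -> Y \in B -> [\/ X = Y, spade form e X Y,
  prec form e X Y | prec form e Y X].
    move=> BX BY; have /forall_inP/(_ Y BY) := P0B X BX.
    by case/or4P=> [/eqP|||]; [apply: Or41|apply: Or42|apply: Or43|apply: Or44].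
  split=> [I J x|I J x] /imsetP[X BX ->] /imsetP[Y BY ->].
    have [pX pY] := (pB X BX, pB Y BY).
    case: (cases X Y BX BY) => [->||/(precP pX pY)[sXY _]|/(precP pY pX)[sYX _]].
    - by rewrite subxx.
    - case/(spadeP pX pY) => dXY _ /imsetP[s sX ->]; rewrite mem_pos.
      by rewrite (disjointFr dXY).
    - by rewrite imsetS // proper_sub.
    - by rewrite [X in _ || X]imsetS ?orbT // proper_sub.
  have [pX pY] := (pB X BX, pB Y BY).
  case: (cases X Y BX BY) => [->//||/(precP pX pY)[_ ns]|/(precP pY pX)[_ ns]];
    last 2 first.
  - by move/ns/negP.
  - by move=> sepX /ns/negP.
  case/(spadeP pX pY) => dXY noE sepX sepY.
  have disj y : y \in pos @: X -> y \notin pos @: Y.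
    by case/imsetP=> s sX ->; rewrite mem_pos (disjointFr dXY).
  have noE' y z : y \in pos @: X -> z \in pos @: Y ->
    (z == y + 1) || (y == z + 1) = false.
    by case/imsetP=> s sX -> /imsetP[t tY ->]; rewrite -edgeE; apply/negbTE/noE.
  move: sepX sepY; rewrite /sep.
  case xX: (x \in _); case x1X: (x + 1 \in _) => // _.
    rewrite (negPf (disj _ xX)); case x1Y: (x + 1 \in _) => // _.
    by have := noE' _ _ xX x1Y; rewrite eqxx.
  rewrite (negPf (disj _ x1X)); case xY: (x \in _) => // _.
  by have := noE' _ _ x1X xY; rewrite eqxx orbT.
move=> a m j /imsetP[X BX defX] odd_m lt_m odd_j lt_j.
have pX := pB X BX.
have : a + j%:R \in pos @: X by rewrite -defX arc_nat // (ltn_trans lt_j).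
case/imsetP=> s sX pos_s.
have : s \in ev form e X.
  rewrite (ev_pos pX (esym defX)) // -pos_s [a + _]addrC addrK val_cyc_nat //.
  exact: ltn_trans lt_m.
have /existsP[C /and4P[/subsetP sC _ /forall_inP precC /subsetP evC]] := P1B X BX.
move/evC => /bigcupP[Y CY sY]; exists (pos @: Y); split.
- by rewrite mem_imgs sC.
- rewrite defX properim; have [] := (precP (pB Y (sC Y CY)) pX).1 => //.
  exact: precC.
by rewrite pos_s mem_pos.
Qed.

Lemma arc_system_phi B : arc_system (imgs B) -> B \in phi form e.
Proof.
move=> [arcB ncB evB].
have pB X : X \in B -> X \in opaths form e.
  by move=> BX; apply/opathsP/arcB; rewrite mem_imgs.
have precB X Y : X \in B -> Y \in B -> X \proper Y -> prec form e X Y.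
  move=> BX BY ltXY; apply/precP; [exact: pB | exact: pB |].
  split=> // x sepX; apply/negP=> sepY; have := ltXY.
  have /(imset_inj pos_inj) -> : pos @: X = pos @: Y.
    by apply: (ncB.2 _ _ x); rewrite ?mem_imgs.
  by rewrite properxx.
have lamB X Y s : X \in B -> Y \in B -> s \in X -> s \in Y -> X != Y ->
    (X \proper Y) || (Y \proper X).
  move=> BX BY sX sY neXY.
  have := ncB.1 (pos @: X) (pos @: Y) (pos s); rewrite !mem_imgs !mem_pos.
  case/(_ BX BY sX sY)/orP => sub; apply/orP; [left|right];
    rewrite -properim properEneq sub andbT.
    by apply: contra neXY => /eqP/(imset_inj pos_inj)/eqP.
  by apply: contra neXY => /eqP/(imset_inj pos_inj)->.
rewrite inE; apply/and3P; split; first by apply/subsetP.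
  apply/forall_inP=> X BX; apply/forall_inP=> Y BY; apply/or4P.
  have [->|neXY] := eqVneq X Y; first by apply: Or41.
  have [dXY|] := boolP [disjoint X & Y]; last first.
    rewrite disjoint_subset => /subsetPn[s sX]; rewrite !inE negbK => sY.
    by case/orP: (lamB X Y s BX BY sX sY neXY) => /precB; [move/(_ BX BY);
      apply: Or43|move/(_ BY BX); apply: Or44].
  apply: Or42; apply/spadeP; [exact: pB | exact: pB | split=> // s t sX tY].
  apply/negP=> gst; case/eqP: neXY; apply: (imset_inj pos_inj).
  have sY : s \notin Y by rewrite (disjointFr dXY).
  have tX : t \notin X by rewrite (disjointFl dXY).
  move: gst; rewrite edgeE => /orP[]/eqP pos_.
    apply: (ncB.2 _ _ (pos s)); rewrite ?mem_imgs // /sep -pos_ !mem_pos.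
      by rewrite sX (negPf tX).
    by rewrite tY (negPf sY).
  apply: (ncB.2 _ _ (pos t)); rewrite ?mem_imgs // /sep -pos_ !mem_pos.
    by rewrite sX (negPf tX).
  by rewrite tY (negPf sY).
apply/forall_inP=> X BX.
(* The maximal members strictly inside [X]; nesting makes them disjoint. *)
apply/existsP; exists [set Y in B | (Y \proper X) &&
  [forall Z in B, (Y \proper Z) ==> ~~ (Z \proper X)]].
apply/and4P; split.
- by apply/subsetP=> Y; rewrite inE => /andP[].
- apply/trivIsetP=> Y Z; rewrite !inE => /and3P[BY YX /forall_inP maxY].
  case/and3P=> BZ ZX /forall_inP maxZ neYZ; rewrite disjoint_subset.
  apply/subsetP=> s sY; rewrite !inE; apply/negP=> sZ.
  case/orP: (lamB Y Z s BY BZ sY sZ neYZ) => [YZ|ZY].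
    by have := maxY Z BZ; rewrite YZ ZX.
  by have := maxZ Y BY; rewrite ZY YX.
- by apply/forall_inP=> Y; rewrite inE => /and3P[BY YX _]; apply: precB.
apply/subsetP=> s sev; have sX : s \in X by move: sev; rewrite inE => /andP[].
have [a [m [odd_m lt_m defX]]] := opaths_arc (pB X BX).
move: sev; rewrite (ev_pos (pB X BX) defX) // => odd_j.
have : pos s \in carc a m by rewrite -defX mem_pos.
rewrite mem_arc => lt_j.
have [|J [/imsetP[Y0 BY0 ->]]] := evB a m _ _ odd_m lt_m odd_j lt_j.
  by rewrite -defX mem_imgs.
rewrite -defX properim natr_Zp addrC subrK mem_pos => YX0 sY0.
have P0' : [&& Y0 \in B, Y0 \proper X & s \in Y0] by rewrite BY0 YX0.
(* A member of largest size between [s] and [X] is maximal for inclusion. *)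
case: (arg_maxnP (P := [pred Y | [&& Y \in B, Y \proper X & s \in Y]])
         (fun Y : {set S} => #|Y|) P0') => Y /= /and3P[BY YX sY] maxY.
apply/bigcupP; exists Y => //; rewrite inE BY YX; apply/forall_inP=> Z BZ.
apply/implyP=> YZ; apply/negP=> ZX; have := maxY Z.
rewrite /= BZ ZX (subsetP (proper_sub YZ) s sY) => /(_ isT).
by rewrite leqNgt proper_card.
Qed.

(* Covers at once the relation e_S = 0 of the quotient case and the vertex
   missing from the path case: a linear relation between the e_s, extended by 0
   off the image of [pos], must be constant around the cycle. *)
Hypothesis rel_const : forall b : T -> bool,
  (forall x, x \notin codom pos -> b x = false) ->
  \sum_s (b (pos s))%:R *: e s = 0 -> forall x, b x = b (x + 1).

(** * Spans as parities of multiplicities *)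

Lemma sum_esum (s : seq {set S}) : uniq s ->
  \sum_(X <- s) esum e X = \sum_t (odd (mult [set X in s] t))%:R *: e t.
Proof.
move=> uniq_s; rewrite /esum; under eq_bigr do rewrite big_mkcond.
rewrite exchange_big; apply: eq_bigr => t _ /=; rewrite -mulrn_F2 -big_mkcond.
rewrite big_const_seq iter_addr_0; congr (_ *+ _); rewrite /mult -size_filter.
rewrite -(card_uniqP (filter_uniq _ uniq_s)); apply: eq_card => X.
by rewrite mem_filter !inE andbC.
Qed.

Lemma odd_sum_F2 (b c : S -> bool) :
  \sum_s (b s)%:R *: e s + \sum_s (c s)%:R *: e s = \sum_s (b s (+) c s)%:R *: e s.
Proof.
rewrite -big_split; apply: eq_bigr => s _ /=; rewrite -scalerDl; congr (_ *: _).
by case: (b s); case: (c s); rewrite ?addr0 ?add0r //; apply: val_inj.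
Qed.

Lemma spanLP B v : v \in spanL e B ->
  exists2 A : {set {set S}}, A \subset B & v = \sum_s (odd (mult A s))%:R *: e s.
Proof.
case/span_map_F2=> s ss ->; exists [set X in s].
  by apply/subsetP=> X; rewrite inE => /(mem_subseq ss); rewrite mem_enum.
by apply: sum_esum; apply: subseq_uniq ss (enum_uniq _).
Qed.

Lemma sum_spanL A B : A \subset B -> \sum_s (odd (mult A s))%:R *: e s \in spanL e B.
Proof.
move=> sAB; have -> : A = [set X in enum A] by apply/setP=> X; rewrite inE mem_enum.
rewrite -sum_esum ?enum_uniq // big_enum; apply: memv_suml => X AX.
by apply: memv_span; apply: image_f; apply: (subsetP sAB).
Qed.

Lemma epsE B : eps e B = \sum_s (tri_odd (mult B s))%:R *: e s.
Proof. by apply: eq_bigr => s _; rewrite natr_F2. Qed.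

Lemma esumE X : esum e X = \sum_s (s \in X)%:R *: e s.
Proof.
rewrite /esum big_mkcond; apply: eq_bigr => s _.
by case: (s \in X); rewrite ?scale1r ?scale0r.
Qed.

Lemma mem_pos_codom X x : x \notin codom pos -> (x \in pos @: X) = false.
Proof. by move=> xpos; apply: contraNF xpos => /(subsetP (pos_sub_codom X)). Qed.

Lemma rel_const_eq (b c : T -> bool) :
    (forall x, x \notin codom pos -> b x = false) ->
    (forall x, x \notin codom pos -> c x = false) ->
    \sum_s (b (pos s))%:R *: e s = \sum_s (c (pos s))%:R *: e s ->
  forall x, b x (+) c x = b (x + 1) (+) c (x + 1).
Proof.
move=> b0 c0 eq_bc; apply: (rel_const (b := fun x => b x (+) c x)).
  by move=> x xpos; rewrite b0 ?c0.
by rewrite -odd_sum_F2 eq_bc addvv_F2.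
Qed.

(** A relation among the e_I for [I] in [A] makes the parity of the depth of [A] constant around the
    cycle, yet it changes at an end of any member of [A]. The equality B = B_L is [span_mem]. *)
Lemma phi_basis B : B \in phi form e ->
  basis_of (spanL e B) [seq esum e X | X in B] /\ B = setL form e (spanL e B).
Proof.
move=> phiB; have sysB := phi_arc_system phiB; have [arcB ncB _] := sysB.
have mult0 A x : x \notin codom pos -> odd (mult (imgs A) x) = false.
  by move=> xpos; rewrite mult_imgs0.
split.
  rewrite /basis_of eqxx; apply: free_map_F2 => s' ss' sum0.
  have uniq_s' : uniq s' := subseq_uniq ss' (enum_uniq _).
  set A : {set {set S}} := [set X in s'].
  have sAB : A \subset B.
    by apply/subsetP=> X; rewrite inE => /(mem_subseq ss'); rewrite mem_enum.
  have ncA := noncrossing_sub (imsetS _ sAB : imgs A \subset imgs B) ncB.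
  case: s' @A {ss'} sum0 uniq_s' sAB ncA => // X s' A sum0 uniq_s' sAB ncA.
  have AX : X \in A by rewrite inE mem_head.
  have [|x sepX] := @oarc_sep _ (pos @: X).
    by apply: arcB; rewrite mem_imgs (subsetP sAB).
  have : [exists I in imgs A, sep x I].
    by apply/existsP; exists (pos @: X); rewrite mem_imgs AX.
  rewrite -odd_mult_sep //; case/eqP.
  apply: (rel_const (b := fun x => odd (mult (imgs A) x))) => //; first exact: mult0.
  move: sum0; rewrite sum_esum // => sum0; apply: etrans sum0.
  by apply: eq_bigr => t _; rewrite mult_imgs.
apply/setP=> X; rewrite inE; apply/idP/andP => [BX|[pX]].
  split; first by move: phiB; rewrite inE => /and3P[/subsetP->].
  by apply: memv_span; apply: image_f.
case/spanLP=> A sAB eqX; rewrite -mem_imgs.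
apply: (@span_mem _ (imgs A) _ _ oddN sysB); first exact: imsetS.
  exact/opathsP.
apply: (rel_const_eq (b := fun x => x \in pos @: X)
         (c := fun x => odd (mult (imgs A) x))) => [x|x|].
- exact: mem_pos_codom.
- exact: mult0.
rewrite [RHS](eq_bigr (fun s => (odd (mult A s))%:R *: e s)) => [|s _]; last first.
  by rewrite mult_imgs.
by rewrite -eqX esumE; apply: eq_bigr => s _; rewrite mem_pos.
Qed.

Lemma phi_eps B : B \in phi form e -> eps e B \in spanL e B.
Proof.
move=> phiB; have [_ ncB _] := phi_arc_system phiB.
have [|A sAB triA] := @laminar_tri_odd S B.
  move=> X Y s BX BY sX sY; have := ncB.1 (pos @: X) (pos @: Y) (pos s).
  by rewrite !mem_imgs !mem_pos !imset_sub_pos; apply.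
rewrite epsE (eq_bigr (fun s => (odd (mult A s))%:R *: e s)) => [|s _].
  exact: sum_spanL.
by rewrite triA.
Qed.

(** Equal values of [eps] give classes that differ by a constant around the cycle; by
    [admissible_inj] these determine the depth, and the depth determines the family. *)
Lemma eps_inj : {in phi form e &, injective (eps e)}.
Proof.
move=> B B' phiB phiB'; rewrite !epsE => eq_eps.
have [sysB sysB'] := (phi_arc_system phiB, phi_arc_system phiB').
apply: (imset_inj (imset_inj pos_inj)); apply: mult_inj => //.
apply: admissible_inj => //; try exact: mult_admissible.
apply: (rel_const_eq (b := fun x => tri_odd (mult (imgs B) x))
         (c := fun x => tri_odd (mult (imgs B') x))) => [x xpos|x xpos|].
- by rewrite mult_imgs0.
- by rewrite mult_imgs0.
transitivity (\sum_s (tri_odd (mult B s))%:R *: e s).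
  by apply: eq_bigr => s _; rewrite mult_imgs.
by rewrite eq_eps; apply: eq_bigr => s _; rewrite mult_imgs.
Qed.

(** One family settles both surjectivity and domination: the level arcs of the relabelled depth
    given by [label_admissible]. *)
Lemma eps_onto B v : B \in phi form e -> v \in spanL e B ->
  exists2 B', B' \in phi form e & eps e B' = v /\ forall s, (mult B' s <= mult B s)%N.
Proof.
move=> phiB /spanLP[A sAB ->]; have sysB := phi_arc_system phiB.
have [h [adm h_le h_tri]] :=
  label_admissible sysB (imsetS _ sAB : imgs A \subset imgs B).
have mult_h := mult_level_arcs oddN adm.
(* Off the image of [pos] the depth of [B] is 0, hence so is [h], and no level arc passes there. *)
have sub_pos (I : {set T}) : I \in level_arcs h -> I \subset codom pos.
  move=> hI; apply/subsetP=> x xI; apply/negPn/negP=> xpos.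
  have : (0 < mult (level_arcs h) x)%N by apply/card_gt0P; exists I; rewrite in_set hI.
  by rewrite mult_h; have := h_le x; rewrite mult_imgs0 // leqn0 => /eqP->.
pose B' := [set X : {set S} | pos @: X \in level_arcs h].
have imgsB' : imgs B' = level_arcs h.
  apply/setP=> I; apply/imsetP/idP => [[X + ->]|hI]; first by rewrite in_set.
  by exists (pos @^-1: I);
    rewrite ?(in_set (fun X => pos @: X \in _)) pos_preim ?sub_pos.
have multB' s : mult B' s = h (pos s) by rewrite -mult_imgs imgsB' mult_h.
exists B'; first by apply: arc_system_phi; rewrite imgsB'; apply: level_arcs_system.
split=> [|s]; last by rewrite multB' -mult_imgs.
by rewrite epsE; apply: eq_bigr => s _; rewrite multB' h_tri mult_imgs.
Qed.

Theorem perfect_of_pos : perfect form e.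
Proof.
split=> [B|B||v|B B' phiB phiB' /(eps_onto phiB)[B2 phiB2 [eq_eps le_mult]] s].
- exact: phi_basis.
- exact: phi_eps.
- exact: eps_inj.
- by case/exists_inP=> B phiB /(eps_onto phiB)[B' phiB' [eq_eps _]]; exists B'.
(* By injectivity [B'] is the family that was constructed inside the bound of [B]. *)
by rewrite -(eps_inj phiB2 phiB' eq_eps).
Qed.

End Transfer.

(** * The path, the cycle and its quotient *)

Lemma isog_on_index (S : finType) (g : rel S) m (h : rel 'I_m.+1) :
  isog_on g [set: S] h ->
  exists2 p : S -> 'I_m.+1, bijective p & forall s t, g s t = h (p s) (p t).
Proof.
case/existsP=> f /and3P[/injectiveP f_inj /eqP f_onto /forallP f_rel].
pose p s := odflt ord0 [pick i | f i == s].
have fK : cancel p f.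
  move=> s; rewrite /p; case: pickP => [i /eqP//|nof].
  have: s \in [set f i | i : 'I_m.+1] by rewrite f_onto inE.
  by case/imsetP=> i _ def_s; have := nof i; rewrite def_s eqxx.
have pK : cancel f p by move=> i; apply: f_inj; rewrite fK.
exists p => [|s t]; first by exists f.
by have /forallP/(_ (p t))/eqP := f_rel (p s); rewrite !fK.
Qed.

Section Basis.
Variables (V : vectType 'F_2) (form : {biscalar V}) (S : finType) (e : S -> V).
Hypothesis form_alt : alternating form.
Hypothesis e_basis : basis_of {:V} [seq e s | s : S].

Lemma basis_sum0 (k : S -> 'F_2) : \sum_s k s *: e s = 0 -> forall s, k s = 0.
Proof.
move=> sum0 s; have /andP[_ free_e] := e_basis.
have /freeP/(_ (fun i => k (enum_val i))) : free (codom_tuple e) by [].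
rewrite -[s]enum_rankK; apply; rewrite -[RHS]sum0.
rewrite [RHS](reindex _ (onW_bij _ (enum_val_bij S))) /=.
by apply: eq_bigr => i _; rewrite (nth_codom 0 e).
Qed.

Lemma basis_decomp v : exists k : S -> 'F_2, v = \sum_s k s *: e s.
Proof.
have /andP[/eqP span_e _] := e_basis; have : v \in <<codom_tuple e>>%VS.
  by rewrite [<<_>>%VS]span_e memvf.
move/coord_span=> ->; exists (fun s => coord (codom_tuple e) (enum_rank s) v).
rewrite [RHS](reindex _ (onW_bij _ (enum_val_bij S))) /=.
by apply: eq_bigr => i _; rewrite (nth_codom 0 e) enum_valK.
Qed.

Lemma alternating_sym x y : form x y = form y x.
Proof.
have := form_alt (x + y); rewrite linearDl !linearDr !form_alt add0r addr0.
by move/eqP; rewrite addr_eq0 => /eqP->; apply: val_inj; case: (form y x) => -[|[|]].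
Qed.

Lemma basis_rel_false (b : S -> bool) :
  \sum_s (b s)%:R *: e s = 0 -> forall s, b s = false.
Proof. by move=> sum0 s; have := basis_sum0 sum0 s; case: (b s). Qed.

Section PathCase.
Variables (n : nat) (p : S -> 'I_n.+2).
Hypothesis oddN : odd n.+3.
Hypothesis p_inj : injective p.
Hypothesis p_edge : forall s t, edge form e s t = path_rel (p s) (p t).

Lemma path_perfect : perfect form e.
Proof.
(* The shift by 1 leaves vertex 0 of the cycle free, which separates the two ends of the path. *)
pose pos s : 'I_n.+3 := (p s).+1%:R.
have lt_p s : ((p s).+1 < n.+3)%N by rewrite ltnS.
have posD1 s : (pos s + 1 : 'I_n.+3) = (if (p s).+2 == n.+3 then 0%N else (p s).+2) :>
  nat.
  by rewrite val_cycD1 val_cyc_nat.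
apply: (@perfect_of_pos _ _ _ _ _ pos) => //.
- move=> s t /(congr1 (@nat_of_ord _)); rewrite !val_cyc_nat // => -[/ord_inj].
  exact: p_inj.
- move=> s t; rewrite p_edge /path_rel /=.
  rewrite -![pos _ == _](inj_eq (@ord_inj _)) !posD1 !val_cyc_nat //.
  have := ltn_ord (p s); have := ltn_ord (p t).
  move: (nat_of_ord (p s)) (nat_of_ord (p t)) => i j; clear.
  by case: (i.+2 =P n.+3) => ?; case: (j.+2 =P n.+3) => ? ? ?; apply/idP/idP; lia.
move=> b b0 sum0 x.
have b_false y : b y = false.
  by have [/codomP[s ->]|/b0//] := boolP (y \in codom pos);
    apply: (basis_rel_false sum0).
by rewrite !b_false.
Qed.

End PathCase.

Section CycleCase.
Variables (n : nat) (p : S -> 'I_n.+3).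
Hypothesis oddN : odd n.+3.
Hypothesis p_bij : bijective p.
Hypothesis p_edge : forall s t, edge form e s t = cycle_rel (p s) (p t).

Lemma cycle_edge s t : edge form e s t = (p t == p s + 1) || (p s == p t + 1).
Proof.
have valD1 (x : 'I_n.+3) : (x + 1 : 'I_n.+3) = (x.+1 %% n.+3)%N :> nat.
  by rewrite /= (modn_small (_ : 1 < n.+3)%N) // addn1.
rewrite p_edge /cycle_rel /= -![p _ == _](inj_eq (@ord_inj _)) !valD1.
by rewrite [_ == p t :> nat]eq_sym [_ == p s :> nat]eq_sym.
Qed.

Lemma cycle_perfect : perfect form e.
Proof.
apply: (perfect_of_pos oddN (bij_inj p_bij) cycle_edge) => b _ sum0 x.
have b_false y : b y = false.
  have [q _ pK] := p_bij; rewrite -(pK y).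
  exact: (basis_rel_false (b := fun s => b (p s)) sum0).
by rewrite !b_false.
Qed.

(** Each vertex of the cycle has exactly two neighbours, distinct because N is at least 3, and 1 + 1
    = 0. *)
Lemma esumT_radical v : form (esum e [set: S]) v = 0.
Proof.
have [k ->] := basis_decomp v; rewrite linear_sumr big1 // => t _.
rewrite linearZr_LR /= /esum linear_sumlz.
have formE s : form (e s) (e t) = (p s == p t - 1)%:R + (p s == p t + 1)%:R.
  have <- : (edge form e s t)%:R = form (e s) (e t).
    rewrite /edge /=; have [->|_] := eqVneq s t; first by rewrite form_alt.
    by case: (form (e s) (e t)) => -[|[|//]] i; apply: val_inj.
  rewrite cycle_edge -[p s == p t - 1](inj_eq (addIr 1)) subrK [p t == _]eq_sym.
  have [eq1|_] := eqVneq (p s + 1) (p t); last by rewrite add0r.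
  rewrite -eq1 -addrA -[X in X == _]addr0 (inj_eq (addrI _)) addr0.
  by rewrite -(inj_eq (@ord_inj _)) val_cycD1.
have sum1 x : \sum_s (p s == x)%:R = 1 :> 'F_2.
  have [q pK qK] := p_bij; rewrite (bigD1 (q x)) //= qK eqxx big1 ?addr0 // => s ne.
  by case: eqP => // def_x; rewrite -def_x pK eqxx in ne.
rewrite (eq_big predT (fun s => (p s == p t - 1)%:R + (p s == p t + 1)%:R)) => [|s|s _].
- by rewrite big_split /= !sum1 -[X in _ * X]/(2%:R) pchar_Zp ?mulr0.
- by rewrite inE.
exact: formE.
Qed.

Let U : {vspace V} := <[esum e [set: S]]>%VS.

(** The form descends because e_S lies in the radical. The only new relation is e_S = 0, whose
    coefficients are constant around the cycle. *)
Lemma cycle_quot_perfect : exists formq : {biscalar quotv U},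
  [/\ forall x y : V, formq (piv U x) (piv U y) = form x y,
      alternating formq & perfect formq (piv U \o e)].
Proof.
pose ff (x y : quotv U) := form (reprv x) (reprv y).
have radl u v : u \in U -> form u v = 0.
  by case/vlineP=> k ->; rewrite linearZl_LR /= esumT_radical mulr0.
have radr u v : u \in U -> form v u = 0 by move=> Uu; rewrite alternating_sym radl.
have ffE x y : ff (piv U x) (piv U y) = form x y.
  have eqU z : reprv (piv U z) - z \in U by rewrite -piv_eqE reprvK.
  have /eqP := radl _ (reprv (piv U y)) (eqU x); rewrite linearBl subr_eq0 => /eqP eqx.
  have /eqP := radr _ x (eqU y); rewrite linearBr subr_eq0 => /eqP eqy.
  by rewrite /ff eqx eqy.
have ff_bil : bilinear_for *%R *%R ff.
  split=> [y' a x1 x2|x' a y1 y2].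
    rewrite -[y']reprvK -[x1]reprvK -[x2]reprvK -linearP !ffE.
    by rewrite linearDl linearZl_LR.
  rewrite -[x']reprvK -[y1]reprvK -[y2]reprvK -linearP !ffE.
  by rewrite linearDr linearZr_LR.
have [formq formqE] : exists formq : {biscalar quotv U},
    forall x y, formq (piv U x) (piv U y) = form x y.
  pose ffB := bilinear_isBilinear.Build _ _ _ _ _ _ ff ff_bil.
  by exists (HB.pack_for {biscalar quotv U} ff ffB) => x y; apply: ffE.
exists formq; split=> [//|x|]; first by rewrite -[x]reprvK formqE.
apply: (perfect_of_pos oddN (bij_inj p_bij)) => [s t|b _ sum0 x].
  by rewrite -cycle_edge /edge /= formqE.
(* A relation in the quotient lifts to a multiple of e_S; comparing coefficients in the basis shows
   that [b] is constant. *)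
have sumU : \sum_s (b (p s))%:R *: e s \in U.
  rewrite -[X in X \in _]subr0 -piv_eqE linear_sum linear0 /= -[X in _ == X]sum0.
  by apply/eqP; apply: eq_bigr => s _; rewrite linearZ.
case/vlineP: sumU => k sumU.
have b_const y : (b y)%:R = k.
  have [q _ qK] := p_bij; rewrite -(qK y); apply/eqP; rewrite -subr_eq0; apply/eqP.
  move: (q y); apply: (basis_sum0 (k := fun s => (b (p s))%:R - k)).
  under eq_bigr do rewrite scalerBl.
  rewrite sumrB sumU /esum scaler_sumr.
  by apply/eqP; rewrite subr_eq0; apply/eqP; apply: eq_bigl => s; rewrite inE.
by have := b_const x; rewrite -(b_const (x + 1)); case: (b x);
  case: (b (x + 1)) => // /eqP.
Qed.

End CycleCase.

End Basis.

Theorem theorem1p4 (N : nat) (N_ge3 : (3 <= N)%N) (N_odd : odd N)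
    (V : vectType 'F_2) (form : {biscalar V}) (form_alt : alternating form)
    (S : finType) (e : S -> V) (e_basis : basis_of {:V} [seq e s | s : S]) :
  [/\ isog_on (edge form e) [set: S] (@path_rel N.-1) -> perfect form e,
      isog_on (edge form e) [set: S] (@cycle_rel N) -> perfect form e
    & isog_on (edge form e) [set: S] (@cycle_rel N) ->
      let U : {vspace V} := <[esum e [set: S]]>%VS in
      exists formq : {biscalar quotv U},
        [/\ forall x y : V, formq (piv U x) (piv U y) = form x y,
            alternating formq
          & perfect formq (piv U \o e)]].
Proof.
case: N N_ge3 N_odd => [|[|[|n]]] // _ oddN; split=> /isog_on_index[p p_bij p_edge].
- by apply: path_perfect p_edge => //; apply: bij_inj.
- exact: cycle_perfect p_edge.
exact: cycle_quot_perfect p_edge.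
Qed.
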